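(* Let $G$ be the Klein four-group, let $\Bbbk$ be a field of characteristic $2$, and let $\chi$ be the set of the three subgroups of order $2$ of $G$. Let $\alpha_1,\alpha_2\in H^*_{\chi}(G,\Bbbk)$, both (homogeneous) of strictly positive degree. Then $\alpha_1\smile\alpha_2=0$.
   Context: All modules are finitely generated. The field $\Bbbk$ is not assumed algebraically closed, and $\Bbbk$ also denotes the trivial module. A $\Bbbk G$-module $M$ is projective relative to $\chi$ if it is a direct summand of $\bigoplus_{H\in\chi} M\downarrow_H\uparrow^G$. A $\Bbbk G$-homomorphism is $\chi$-split if it splits on restriction to each $H\in\chi$. The relative projective cover of $M$ is the pair $(Q_0,\pi_0)$ with $Q_0$ of smallest possible dimension such that $Q_0$ is projective relative to $\chi$ and $\pi_0:Q_0\to M$ is a surjective $\chi$-split $\Bbbk G$-homomorphism; its kernel, unique up to isomorphism, is $\Omega_\chi(M)$. Set $\Omega^i_\chi(M)=\Omega_\chi(\Omega_\chi^{i-1}(M))$ for $i \geq 1$, with $\Omega^0_\chi(\Bbbk)=\Bbbk$. Relative cohomology $H^i_\chi(G,N)=\mathrm{Ext}^i_{\Bbbk G,\chi}(\Bbbk,N)$ is the $i$-th homology of the complex $0\to\mathrm{Hom}_{\Bbbk G}(Q_0,N)\to\mathrm{Hom}_{\Bbbk G}(Q_1,N)\to\cdots$, where $\cdots\to Q_1\to Q_0\to\Bbbk\to 0$ is a relative projective resolution (an exact complex, each $Q_i$ projective relative to $\chi$, with the connecting homomorphisms splitting over each $H\in\chi$). Let $\underline{\mathrm{Hom}}^\chi_{\Bbbk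 G}(M,N)$ be the quotient of $\mathrm{Hom}_{\Bbbk G}(M,N)$ by the subspace of homomorphisms which factor through a module projective relative to $\chi$. For $i>0$ one has $H^i_\chi(G,\Bbbk)\cong\underline{\mathrm{Hom}}^\chi_{\Bbbk G}(\Omega^i_\chi(\Bbbk),\Bbbk)$. For $f\in\mathrm{Hom}_{\Bbbk G}(M,N)$ with relative projective covers $(Q,\pi)$ of $M$ and $(Q',\pi')$ of $N$, there is $\bar f\in\mathrm{Hom}_{\Bbbk G}(Q,Q')$ with $\pi'\bar f=f\pi$; its restriction to $\ker\pi$ is a homomorphism $\Omega_\chi(f):\Omega_\chi(M)\to\Omega_\chi(N)$, well defined modulo homomorphisms factoring through a module projective relative to $\chi$. $\Omega_\chi^i(f)$ is obtained by iterating. Cup product: for $i,j>0$, $\alpha\in H^i_\chi(G,\Bbbk)$ and $\beta\in H^j_\chi(G,\Bbbk)$ represented by $f\in\mathrm{Hom}_{\Bbbk G}(\Omega^i_\chi(\Bbbk),\Bbbk)$ and $g\in\mathrm{Hom}_{\Bbbk G}(\Omega^j_\chi(\Bbbk),\Bbbk)$, $\alpha\smile\beta\in H^{i+j}_\chi(G,\Bbbk)$ is the class represented by $f\circ\Omega^i_\chi(g)\in\mathrm{Hom}_{\Bbbk G}(\Omega^{i+j}_\chi(\Bbbk),\Bbbk)$. *)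

(* Defs.v *)
From HB Require Import structures.
From mathcomp Require Import all_boot all_order all_algebra all_fingroup.
From mathcomp Require Import all_solvable all_field all_character.
From mathcomp Require Import boolp.

Set Implicit Arguments.
Unset Strict Implicit.
Unset Printing Implicit Defensive.

Import GRing.Theory.
Local Open Scope ring_scope.
Local Open Scope quotient_scope.

(* The ambient finite group is the full group [set: gT] of a finGroupType, so
   that every H : {group gT} is a subgroup of it. A finitely generated kG-module
   is a matrix representation, acting on row vectors on the right; accordingly
   homomorphisms are matrices acting on the right, and "f, then g" is f *m g. *)
Notation kGmod F gT := (@representation F gT [set: gT]%G).

Section Homs.
Variables (F : fieldType) (gT : finGroupType).
Implicit Types (M N : kGmod F gT) (H : {set gT}).

Definition repr_hom H M N : {pred 'M[F]_(rdegree M, rdegree N)} :=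
  [pred f : 'M[F]_(rdegree M, rdegree N) | [forall x in H, M x *m f == f *m N x]].

Arguments repr_hom H M N : clear implicits.

Lemma repr_homP H M N (f : 'M[F]_(rdegree M, rdegree N)) :
  reflect (forall x, x \in H -> M x *m f = f *m N x) (f \in repr_hom H M N).
Proof. by apply: (iffP forall_inP) => h x /h/eqP. Qed.

Fact repr_hom_zmod_closed H M N : zmod_closed (repr_hom H M N).
Proof.
split=> [|f g /repr_homP hf /repr_homP hg]; apply/repr_homP=> x Hx.
  by rewrite mulmx0 mul0mx.
by rewrite mulmxBr mulmxBl hf ?hg.
Qed.
HB.instance Definition _ H M N :=
  GRing.isZmodClosed.Build _ (repr_hom H M N) (repr_hom_zmod_closed H M N).

Record kGhom M N := KGHom {
  kGhom_mx :> 'M[F]_(rdegree M, rdegree N);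
  kGhomP : kGhom_mx \in repr_hom [set: gT] M N }.

HB.instance Definition _ M N := [isSub for @kGhom_mx M N].
HB.instance Definition _ M N := [Choice of kGhom M N by <:].
HB.instance Definition _ M N := [SubChoice_isSubZmodule of kGhom M N by <:].

Lemma kGhomE M N (f : kGhom M N) x : M x *m f = f *m N x.
Proof. by have /repr_homP := kGhomP f; apply; rewrite inE. Qed.

Lemma kGhom_intro M N (f : 'M[F]_(rdegree M, rdegree N)) :
  (forall x, M x *m f = f *m N x) -> f \in repr_hom [set: gT] M N.
Proof. by move=> h; apply/repr_homP. Qed.

Lemma kGcomp_subproof M N P (f : kGhom M N) (g : kGhom N P) :
  f *m g \in repr_hom [set: gT] M P.
Proof. by apply: kGhom_intro => x; rewrite mulmxA kGhomE -!mulmxA kGhomE. Qed.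

Definition kGcomp M N P (f : kGhom M N) (g : kGhom N P) : kGhom M P :=
  KGHom (kGcomp_subproof f g).

Lemma trivial_mx_repr : mx_repr [set: gT] (fun _ : gT => 1%:M : 'M[F]_1).
Proof. by split=> // x y _ _; rewrite mulmx1. Qed.

Definition trivial_mod : kGmod F gT :=
  @Representation _ _ [set: gT]%G 1 (MxRepresentation trivial_mx_repr).

End Homs.

Arguments repr_hom {F gT} H M N.
Arguments trivial_mod {F gT}.

Section Induction.
Variables (F : fieldType) (gT : finGroupType).
Implicit Types (M N : kGmod F gT) (H : {group gT}).

Definition restrict M H : mx_representation F H (rdegree M) :=
  subg_repr M (subsetT H).

Section Induced.
Variables (H : {group gT}) (n : nat) (s : mx_representation F H n).
Local Notation k := #|rcosets H [set: gT]|.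

Definition coset_rep (i : 'I_k) : gT := repr (enum_val i).
Local Notation t := coset_rep.

(* V (x)_{kH} kG, with basis v (x) t_i where the t_i represent the right cosets
   of H: if t_i g = h t_j with h in H, then (v (x) t_i) g = (v h) (x) t_j. *)
Definition ind_mx (g : gT) : 'M[F]_(\sum_(i < k) n) :=
  \mxblock_(i < k, j < k)
    (if (t i * g * (t j)^-1)%g \in H then s (t i * g * (t j)^-1)%g else 0).

Lemma coset_repK i : (enum_val i = H :* t i)%g.
Proof.
have /rcosetsP[x _ e] := enum_valP i.
rewrite /coset_rep e; apply/esym/rcoset_eqP.
exact: (mem_repr x (rcoset_refl H x)).
Qed.

Lemma coset_rep_ex (x : gT) : exists j, (x * (t j)^-1)%g \in H.
Proof.
have Hx : (H :* x)%g \in rcosets H [set: gT].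
  by apply/rcosetsP; exists x; rewrite ?inE.
exists (enum_rank_in Hx (H :* x)%g).
by rewrite -mem_rcoset -coset_repK enum_rankK_in // rcoset_refl.
Qed.

Lemma coset_rep_uniq x i j :
  (x * (t i)^-1)%g \in H -> (x * (t j)^-1)%g \in H -> i = j.
Proof.
rewrite -!mem_rcoset -!coset_repK => hi hj; apply: enum_val_inj.
have /rcosetsP[a _ ea] := enum_valP i; have /rcosetsP[b _ eb] := enum_valP j.
by rewrite ea eb in hi hj *; rewrite -(rcoset_eqP hi) -(rcoset_eqP hj).
Qed.

Lemma ind_sum m (x : gT) (A : 'I_k -> 'M[F]_(n, m)) j :
  (x * (t j)^-1)%g \in H ->
  \sum_(i < k) (if (x * (t i)^-1)%g \in H then s (x * (t i)^-1)%g else 0) *m A i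
  = s (x * (t j)^-1)%g *m A j.
Proof.
move=> hj; rewrite (bigD1 j) //= hj big1 ?addr0 // => i nij.
case: ifP => hi; last by rewrite mul0mx.
by rewrite (coset_rep_uniq hi hj) eqxx in nij.
Qed.

Lemma ind_mx_repr : mx_repr [set: gT] ind_mx.
Proof.
split=> [|x y _ _].
  rewrite /ind_mx -mxdiagZ /mxdiag; apply: eq_mxblock => i j.
  rewrite mulg1; case: eqVneq => [->|nij].
    by rewrite mulgV group1 repr_mx1 conform_mx_id.
  case: ifP => // hij; case/eqP: nij.
  by apply: (coset_rep_uniq _ hij); rewrite mulgV group1.
rewrite /ind_mx mul_mxblock; apply: eq_mxblock => i j.
have [l hl] := coset_rep_ex (t i * x)%g.
rewrite (ind_sum _ hl).
have e : (t i * (x * y) * (t j)^-1 =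
          (t i * x * (t l)^-1) * (t l * y * (t j)^-1))%g by rewrite !mulgA mulgKV.
rewrite e groupMl //; case: ifP => h; last by rewrite mulmx0.
by rewrite repr_mxM.
Qed.

Definition induced : kGmod F gT :=
  @Representation _ _ [set: gT]%G _ (MxRepresentation ind_mx_repr).

End Induced.

Definition direct_summand M N : Prop :=
  exists M' : kGmod F gT, mx_rsim N (dadd_grepr M M').

Section Relative.
Variable chi : {set {group gT}}.

Definition res_ind_sum M : kGmod F gT :=
  \big[dadd_grepr/grepr0]_(H in chi) induced (restrict M H).

Definition rel_projective M : Prop := direct_summand M (res_ind_sum M).

Definition splits_on H M N (f : kGhom M N) : Prop :=
  exists2 s : 'M[F]_(rdegree N, rdegree M),
    s \in repr_hom H N M & s *m f = 1%:M.

(* A right inverse over each H: only used for surjective f, for which this is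
   what splitting means. *)
Definition chi_split M N (f : kGhom M N) : Prop :=
  forall H, H \in chi -> splits_on H f.

Definition covers M (Q : kGmod F gT) (p : kGhom Q M) : Prop :=
  [/\ rel_projective Q, row_full p & chi_split p].

Record rel_cover M := RelCover {
  cover_mod : kGmod F gT;
  cover_map : kGhom cover_mod M;
  cover_mapP : covers cover_map;
  cover_min : forall (Q : kGmod F gT) (p : kGhom Q M),
    covers p -> (rdegree cover_mod <= rdegree Q)%N }.

End Relative.
End Induction.

Section Kernels.
Variables (F : fieldType) (gT : finGroupType).
Implicit Types (M N P : kGmod F gT).

Lemma kermx_module M N (f : kGhom M N) : mxmodule M (kermx f).
Proof.
apply/mxmoduleP=> x _; apply/sub_kermxP.
by rewrite -mulmxA kGhomE mulmxA mulmx_ker mul0mx.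
Qed.

Definition ker_mod M N (f : kGhom M N) : kGmod F gT :=
  Representation (submod_repr (kermx_module f)).

Lemma ker_incl_subproof M N (f : kGhom M N) :
  (val_submod 1%:M : 'M_(rdegree (ker_mod f), _))
    \in repr_hom [set: gT] (ker_mod f) M.
Proof.
apply: kGhom_intro => x.
by rewrite -(val_submodJ (kermx_module f)) ?inE // mul1mx -val_submodE.
Qed.

Definition ker_incl M N (f : kGhom M N) : kGhom (ker_mod f) M :=
  KGHom (ker_incl_subproof f).

Lemma ker_inclK M N (f : kGhom M N) : ker_incl f *m f = 0.
Proof. by apply/sub_kermxP; rewrite /= val_submod1. Qed.

Lemma ker_factor P M N (f : kGhom M N) (g : kGhom P M) :
  g *m f = 0 -> exists h : kGhom P (ker_mod f), h *m ker_incl f = g.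
Proof.
move=> gf0; have sg : (g <= kermx f)%MS by apply/sub_kermxP.
have hh : (in_submod (kermx f) g : 'M_(_, rdegree (ker_mod f)))
    \in repr_hom [set: gT] P (ker_mod f).
  apply: kGhom_intro => x.
  by rewrite -(in_submodJ (kermx_module f)) // -(kGhomE g) [LHS]mulmxA.
by exists (KGHom hh); rewrite /= -val_submodE in_submodK.
Qed.

Lemma ker_incl_inj P M N (f : kGhom M N) (g h : 'M_(rdegree P, _)) :
  g *m ker_incl f = h *m ker_incl f -> g = h.
Proof. by rewrite /= -!(val_submodE (U := kermx f)); apply: val_submod_inj. Qed.

Lemma direct_summandP M N :
  direct_summand M N <->
  exists (i : kGhom M N) (p : kGhom N M), i *m p = 1%:M.
Proof.
split=> [[M' [B eB fB hB]]|[i [p ip]]].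
  have [B' BB'] := row_freeP fB.
  have [C CB] : exists C, C *m B = 1%:M.
    by apply/row_fullP; rewrite /row_full (eqP fB) eB.
  have {C CB} B'B : B' *m B = 1%:M.
    by rewrite -[B']mul1mx -CB -(mulmxA C) BB' mulmx1.
  have hB' x : dadd_grepr M M' x *m B' = B' *m N x.
    rewrite -[LHS]mul1mx -[in LHS]B'B -!mulmxA; congr (_ *m _).
    by rewrite (mulmxA B) -hB ?inE // -mulmxA BB' mulmx1.
  have hi : (row_mx 1%:M 0 *m B' : 'M_(rdegree M, rdegree N))
      \in repr_hom [set: gT] M N.
    apply: kGhom_intro => x; rewrite -mulmxA -hB' !mulmxA /=.
    by rewrite mul_mx_row mul_row_block !mulmx0 !mul0mx mulmx1 mul1mx !addr0.
  have hp : (B *m col_mx 1%:M 0 : 'M_(rdegree N, rdegree M))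
      \in repr_hom [set: gT] N M.
    apply: kGhom_intro => x; rewrite mulmxA hB ?inE // -!mulmxA /=.
    congr (_ *m _).
    by rewrite mul_block_col mul_col_mx !mulmx0 !mul0mx mulmx1 mul1mx !addr0.
  exists (KGHom hi), (KGHom hp) => /=.
  by rewrite -mulmxA (mulmxA B') B'B mul1mx mul_row_col mulmx0 mulmx1 addr0.
have hg : (1%:M - p *m i : 'M_(rdegree N, rdegree N)) \in repr_hom [set: gT] N N.
  apply: kGhom_intro => x.
  by rewrite mulmxBr mulmxBl mulmx1 mul1mx mulmxA kGhomE -!mulmxA kGhomE.
have [|q qE] := @ker_factor _ _ _ p (KGHom hg).
  by rewrite /= mulmxBl mul1mx -mulmxA ip mulmx1 subrr.
have rp : \rank p = rdegree M.
  by apply/eqP; apply/row_fullP; exists i.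
exists (ker_mod p); exists (row_mx p q) => [||x _].
- by rewrite /= mxrank_ker rp subnKC // -rp rank_leq_row.
- apply/row_freeP; exists (col_mx i (ker_incl p)).
  by rewrite mul_row_col qE /= addrC subrK.
by rewrite mul_mx_row !kGhomE /= mul_row_block !mulmx0 addr0 add0r.
Qed.

End Kernels.

Section Lifting.
Variables (F : fieldType) (gT : finGroupType) (chi : {set {group gT}}).
Implicit Types (M N P X : kGmod F gT) (H : {group gT}).

Definition lifting P := forall X N (p : kGhom X N), chi_split chi p ->
  forall f : kGhom P N, exists g : kGhom P X, g *m p = f.

Section IndHom.
Variables (H : {group gT}) (n : nat) (s : mx_representation F H n) (N : kGmod F gT).
Local Notation k := #|rcosets H [set: gT]|.
Local Notation t := (@coset_rep gT H).

Lemma ind_colP (A : 'I_k -> 'M[F]_(n, rdegree N)) :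
  \mxcol_i A i \in repr_hom [set: gT] (induced s) N <->
  (forall g i j, (t i * g * (t j)^-1)%g \in H ->
    s (t i * g * (t j)^-1)%g *m A j = A i *m N g).
Proof.
have E g : induced s g *m \mxcol_i A i = (\mxcol_i A i) *m N g <->
    (forall i j, (t i * g * (t j)^-1)%g \in H ->
      s (t i * g * (t j)^-1)%g *m A j = A i *m N g).
  rewrite /= /ind_mx mul_mxblock_mxrow mxcol_mul -eq_mxcolP.
  split=> h i => [j hj|]; first by rewrite -(h i) (ind_sum _ _ hj).
  by have [j hj] := coset_rep_ex H (t i * g)%g; rewrite (ind_sum _ _ hj) h.
split=> [/repr_homP h g|h]; first by apply/E/h; rewrite inE.
by apply: kGhom_intro => g; apply/E/h.
Qed.

End IndHom.

Lemma lifting_ind H n (s : mx_representation F H n) :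
  H \in chi -> lifting (induced s).
Proof.
move=> cH X N p /(_ H cH)[w /repr_homP hw wp] f.
pose t := @coset_rep gT H; pose fr i := submxcol f i.
have fE : f = \mxcol_i fr i :> 'M_(_, _) by rewrite submxcolK.
have fJ : \mxcol_i fr i \in repr_hom [set: gT] (induced s) N.
  by rewrite -fE; exact: kGhomP.
move/ind_colP in fJ.
pose A i : 'M[F]_(n, rdegree X) := fr i *m N (t i)^-1%g *m w *m X (t i).
have hA : \mxcol_i A i \in repr_hom [set: gT] (induced s) X.
  apply/ind_colP => g i j hj; set h := (_ * _ * _)%g in hj *.
  have e : (t i * g = h * t j)%g by rewrite /h mulgKV.
  rewrite /A -[RHS]mulmxA -repr_mxM ?inE // e repr_mxM ?inE // !mulmxA.
  rewrite (fJ _ _ _ hj); congr (_ *m _).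
  rewrite -[RHS]mulmxA -hw // -!mulmxA; congr (_ *m _).
  rewrite !mulmxA -!repr_mxM ?inE //; congr (N _ *m _).
  by rewrite /h -!mulgA mulKg.
exists (KGHom hA); rewrite /= fE mxcol_mul; apply: eq_mxcol => i.
rewrite /A -mulmxA kGhomE !mulmxA -[_ *m w *m p]mulmxA wp mulmx1.
by rewrite -mulmxA -repr_mxM ?inE // mulVg repr_mx1 mulmx1.
Qed.

Lemma lifting0 : lifting grepr0.
Proof.
move=> X N p _ f; exists 0; apply/matrixP; by case.
Qed.

Section DaddCol.
Variables (P Q N : kGmod F gT) (u : kGhom P N) (v : kGhom Q N).

Lemma dadd_col_subproof :
  (col_mx u v : 'M_(rdegree (dadd_grepr P Q), _))
    \in repr_hom [set: gT] (dadd_grepr P Q) N.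
Proof.
apply: kGhom_intro => g.
by rewrite /= mul_block_col !mul0mx addr0 add0r !kGhomE mul_col_mx.
Qed.

Definition dadd_col : kGhom (dadd_grepr P Q) N := KGHom dadd_col_subproof.

Lemma splits_dadd_col H : splits_on H u \/ splits_on H v -> splits_on H dadd_col.
Proof.
case=> -[w /repr_homP hw wE].
  exists (row_mx w 0); last by rewrite /= mul_row_col mul0mx addr0.
  apply/repr_homP => g Hg; rewrite mul_mx_row hw // mulmx0 /=.
  by rewrite mul_row_block !mulmx0 !mul0mx !addr0.
exists (row_mx 0 w); last by rewrite /= mul_row_col mul0mx add0r.
apply/repr_homP => g Hg; rewrite mul_mx_row hw // mulmx0 /=.
by rewrite mul_row_block !mulmx0 !mul0mx !add0r.
Qed.

End DaddCol.

Lemma lifting_dadd P Q : lifting P -> lifting Q -> lifting (dadd_grepr P Q).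
Proof.
move=> lP lQ X N p cp f.
have fE : f = col_mx (usubmx f) (dsubmx f) :> 'M_(_, _) by rewrite vsubmxK.
have hf g : P g *m usubmx f = usubmx f *m N g /\ Q g *m dsubmx f = dsubmx f *m N g.
  have h := kGhomE f g.
  rewrite fE /= mul_block_col mul_col_mx !mul0mx addr0 add0r in h.
  exact: eq_col_mx h.
have hu : usubmx f \in repr_hom [set: gT] P N.
  by apply: kGhom_intro => g; case: (hf g).
have hd : dsubmx f \in repr_hom [set: gT] Q N.
  by apply: kGhom_intro => g; case: (hf g).
have [u uE] := lP _ _ p cp (KGHom hu); have [d dE] := lQ _ _ p cp (KGHom hd).
by exists (dadd_col u d); rewrite /= mul_col_mx uE dE -fE.
Qed.

Lemma lifting_sum M : lifting (res_ind_sum chi M).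
Proof.
rewrite /res_ind_sum; elim/big_ind: _ => [||H cH].
- exact: lifting0.
- exact: lifting_dadd.
exact: lifting_ind.
Qed.

Lemma rel_projective_lifting P : rel_projective chi P -> lifting P.
Proof.
move=> /direct_summandP[i [q iq]] X N p cp f.
have [g gE] := lifting_sum cp (kGcomp q f).
by exists (kGcomp i g); rewrite /= -mulmxA gE /= mulmxA iq mul1mx.
Qed.

Lemma counit H M :
  exists c : kGhom (induced (restrict M H)) M, splits_on H c.
Proof.
pose t := @coset_rep gT H.
have hc : \mxcol_i M (t i) \in repr_hom [set: gT] (induced (restrict M H)) M.
  apply/ind_colP => g i j hj /=; rewrite -!repr_mxM ?inE //.
  by rewrite mulgKV.
exists (KGHom hc).
have [o ho] := coset_rep_ex H 1%g.
have to : t o = 1%g.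
  have /rcosetsP[x _ e] := enum_valP o.
  have ho' : t o \in H by rewrite -groupV -[(_^-1)%g]mul1g.
  by rewrite /t /coset_rep coset_repK rcoset_id // repr_group.
pose B j : 'M[F]_(rdegree M) := if j == o then 1%:M else 0.
exists (\mxrow_j B j).
  apply/repr_homP => h Hh; rewrite mul_mxrow /= /ind_mx mul_mxrow_mxblock.
  apply: eq_mxrow => j; rewrite (bigD1 o) //= big1 ?addr0 => [|i nio]; last first.
    by rewrite /B (negPf nio) mul0mx.
  rewrite {2}/B eqxx mul1mx -/t to mul1g /B; case: eqVneq => [->|njo].
    by rewrite -/t to invg1 mulg1 Hh mulmx1.
  rewrite mulmx0; case: ifP => // hj; case/eqP: njo.
  apply: (coset_rep_uniq hj); by rewrite -/t to invg1 mulg1.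
rewrite /= mul_mxrow_mxcol (bigD1 o) //= big1 ?addr0 => [|i nio]; last first.
  by rewrite /B (negPf nio) mul0mx.
by rewrite /B eqxx mul1mx to repr_mx1.
Qed.

Lemma counit_sum M : exists c : kGhom (res_ind_sum chi M) M, chi_split chi c.
Proof.
pose r := [seq H <- index_enum {group gT} | H \in chi].
have [c cE] : exists c : kGhom (\big[dadd_grepr/grepr0]_(H <- r)
    induced (restrict M H)) M, forall H, H \in r -> splits_on H c.
  elim: r => [|H s [c IH]]; first by rewrite big_nil; exists 0.
  rewrite big_cons; have [c0 c0s] := counit H M.
  exists (dadd_col c0 c) => K; rewrite inE => /predU1P[->|/IH cs].
    by apply: splits_dadd_col; left.
  by apply: splits_dadd_col; right.
rewrite /res_ind_sum -big_filter; exists c => H cH; apply: cE.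
by rewrite mem_filter cH mem_index_enum.
Qed.

Lemma res_ind_sum_rel_projective M : rel_projective chi (res_ind_sum chi M).
Proof.
apply/direct_summandP; have [c cs] := counit_sum (res_ind_sum chi M).
have h1 : 1%:M \in repr_hom [set: gT] (res_ind_sum chi M) (res_ind_sum chi M).
  by apply: kGhom_intro => g; rewrite mulmx1 mul1mx.
by have [i iE] := lifting_sum cs (KGHom h1); exists i, c.
Qed.

Lemma rel_cover_exists M : chi != set0 -> inhabited (rel_cover chi M).
Proof.
case/set0Pn=> H cH; have [c cs] := counit_sum M.
have cc : covers chi c.
  split=> //; first exact: res_ind_sum_rel_projective.
  by have [w _ wc] := cs H cH; apply/row_fullP; exists w.
pose S n := `[< exists (Q : kGmod F gT) (p : kGhom Q M),
                 covers chi p /\ rdegree Q = n >].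
have exS : exists n, S n by exists (rdegree (res_ind_sum chi M));
  apply/asboolP; exists (res_ind_sum chi M), c.
have [_ /asboolP[Q [p [cp <-]]] minQ] := ex_minnP exS.
constructor; apply: (@RelCover _ _ chi M Q p cp) => Q' p' cp'.
by apply: minQ; apply/asboolP; exists Q', p'.
Qed.

End Lifting.

Section Cohomology.
Variables (F : fieldType) (gT : finGroupType).
Variables (Q : nat -> kGmod F gT) (d : forall n, kGhom (Q n.+1) (Q n)).
Variables (N : kGmod F gT) (i : nat).

(* The degree i homology of 0 -> Hom(Q_0, N) -> Hom(Q_1, N) -> ... as an additive
   group: cocycles modulo coboundaries. *)
Definition is_cocycle : {pred kGhom (Q i) N} :=
  [pred z | kGcomp (d i) z == 0].

Lemma is_cocycleP (z : kGhom (Q i) N) :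
  reflect (d i *m z = 0) (z \in is_cocycle).
Proof.
rewrite inE; apply: (iffP eqP) => [h|h]; last exact: val_inj.
by have := congr1 (@kGhom_mx F gT _ _) h.
Qed.

Fact is_cocycle_zmod_closed : zmod_closed is_cocycle.
Proof.
split=> [|y z /is_cocycleP hy /is_cocycleP hz]; apply/is_cocycleP.
  by rewrite mulmx0.
by rewrite mulmxBr hy hz subr0.
Qed.
HB.instance Definition _ :=
  GRing.isZmodClosed.Build _ is_cocycle is_cocycle_zmod_closed.

Record cocycle := Cocycle {
  cocycle_val :> kGhom (Q i) N; cocycleP : cocycle_val \in is_cocycle }.

HB.instance Definition _ := [isSub for cocycle_val].
HB.instance Definition _ := [Choice of cocycle by <:].
HB.instance Definition _ := [SubChoice_isSubZmodule of cocycle by <:].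

Definition coboundary (n : nat) : kGhom (Q n) N -> Prop :=
  match n with
  | 0 => fun z => z = 0
  | n'.+1 => fun z => exists b : kGhom (Q n') N, z = kGcomp (d n') b
  end.

Lemma coboundary0 n : coboundary (0 : kGhom (Q n) N).
Proof. by case: n => //= n; exists 0; apply: val_inj; rewrite /= mulmx0. Qed.

Lemma coboundaryB n (y z : kGhom (Q n) N) :
  coboundary y -> coboundary z -> coboundary (y - z).
Proof.
case: n y z => [|n] y z /=; first by move=> -> ->; rewrite subrr.
move=> [b ->] [c ->]; exists (b - c); apply: val_inj.
by rewrite /= mulmxBr.
Qed.

Definition is_coboundary : {pred cocycle} := [pred z : cocycle | `[< coboundary z >]].

Fact is_coboundary_zmod_closed : zmod_closed is_coboundary.
Proof.
split=> [|y z]; first by apply/asboolP; exact: coboundary0.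
by move=> /asboolP hy /asboolP hz; apply/asboolP; exact: coboundaryB.
Qed.
HB.instance Definition _ :=
  GRing.isZmodClosed.Build _ is_coboundary is_coboundary_zmod_closed.

Definition cohomology : zmodType := Quotient.quot is_coboundary.

Definition cohomology_class (z : cocycle) : cohomology :=
  \pi_(Quotient.quot is_coboundary) z.

Lemma cohomology_classP (y z : cocycle) :
  cohomology_class y = cohomology_class z <-> coboundary (y - z).
Proof.
split=> [/eqP|h]; last apply/eqP; rewrite -Quotient.idealrBE.
  by move/asboolP.
by apply/asboolP.
Qed.

Lemma cohomology_class_surj (a : cohomology) : exists z, a = cohomology_class z.
Proof. by exists (generic_quotient.repr a); rewrite /cohomology_class generic_quotient.reprK. Qed.

End Cohomology.

Arguments is_cocycle {F gT Q} d N i.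
Arguments cohomology {F gT Q} d N i.

Section RelativeCohomology.
Variables (F : fieldType) (gT : finGroupType) (chi : {set {group gT}}).
Implicit Types (M N : kGmod F gT).

(* A choice of a relative projective cover for every module; one exists as soon
   as chi is nonempty, see rel_cover_exists. *)
Variable C : forall M, rel_cover chi M.

Definition Omega M : kGmod F gT := ker_mod (cover_map (C M)).

Definition Omega_incl M : kGhom (Omega M) (cover_mod (C M)) :=
  ker_incl (cover_map (C M)).

Definition is_Omega_map M N (f : kGhom M N) (h : kGhom (Omega M) (Omega N)) : Prop :=
  exists2 fbar : kGhom (cover_mod (C M)) (cover_mod (C N)),
    fbar *m cover_map (C N) = cover_map (C M) *m f &
    h *m Omega_incl N = Omega_incl M *m fbar.

Lemma Omega_map_exists M N (f : kGhom M N) : exists h, is_Omega_map f h.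
Proof.
have [pQ _ _] := cover_mapP (C M); have [_ _ sN] := cover_mapP (C N).
have [b bE] := rel_projective_lifting pQ sN (kGcomp (cover_map (C M)) f).
have [|h hE] := @ker_factor _ _ _ _ _ (cover_map (C N)) (kGcomp (Omega_incl M) b).
  by rewrite /= -mulmxA bE /= mulmxA ker_inclK mul0mx.
by exists h, b.
Qed.

Definition Omega_map M N (f : kGhom M N) : kGhom (Omega M) (Omega N) :=
  sval (cid (Omega_map_exists f)).

Definition Omega_n (n : nat) : kGmod F gT := iter n Omega trivial_mod.

(* Splicing Omega^(n+1) -> Q_n -> Omega^n gives the minimal relative projective
   resolution of the trivial module. *)
Definition res_mod (n : nat) : kGmod F gT := cover_mod (C (Omega_n n)).

Definition res_aug (n : nat) : kGhom (res_mod n) (Omega_n n) :=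
  cover_map (C (Omega_n n)).

Definition res_diff (n : nat) : kGhom (res_mod n.+1) (res_mod n) :=
  kGcomp (res_aug n.+1) (Omega_incl (Omega_n n)).

Definition rel_cohomology (i : nat) (N : kGmod F gT) : zmodType :=
  cohomology res_diff N i.

Lemma res_diff_aug n : res_diff n *m res_aug n = 0.
Proof. by rewrite /= -mulmxA ker_inclK mulmx0. Qed.

Section Represented.
Variables (i : nat) (N : kGmod F gT).

Lemma class_of_hom_subproof (f : kGhom (Omega_n i) N) :
  kGcomp (res_aug i) f \in is_cocycle res_diff N i.
Proof. by apply/is_cocycleP; rewrite [X in _ *m X]/= mulmxA res_diff_aug mul0mx. Qed.

(* The element of H^i represented by f is the class of Q_i -> Omega^i -> N. *)
Definition class_of_hom (f : kGhom (Omega_n i) N) : rel_cohomology i N :=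
  cohomology_class (Cocycle (class_of_hom_subproof f)).

Lemma class_of_hom_surj (a : rel_cohomology i N) : exists f, class_of_hom f = a.
Proof.
have [z ->] := cohomology_class_surj a.
have /is_cocycleP dz := cocycleP z.
have aug_surj n : row_full (res_aug n) by have [] := cover_mapP (C (Omega_n n)).
have [s sE] := row_fullP (aug_surj i).
have iz : Omega_incl (Omega_n i) *m z = 0.
  have [w wE] := row_fullP (aug_surj i.+1).
  have e : res_aug i.+1 *m (Omega_incl (Omega_n i) *m z) = 0.
    by rewrite mulmxA; exact: dz.
  by rewrite -[LHS]mul1mx -wE -[LHS]mulmxA e mulmx0.
have kz : kermx (res_aug i) *m z = 0.
  have /submxP[D ->] : (kermx (res_aug i) <= Omega_incl (Omega_n i))%MS.
    by rewrite /= val_submod1.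
  by rewrite -mulmxA iz mulmx0.
have szE : res_aug i *m (s *m z) = z.
  apply/eqP; rewrite mulmxA -subr_eq0 -[X in _ - X]mul1mx -mulmxBl.
  have /submxP[D ->] : (res_aug i *m s - 1%:M <= kermx (res_aug i))%MS.
    by apply/sub_kermxP; rewrite mulmxBl mul1mx -mulmxA sE mulmx1 subrr.
  by rewrite -mulmxA kz mulmx0.
have hf : s *m z \in repr_hom [set: gT] (Omega_n i) N.
  apply: kGhom_intro => g.
  transitivity (s *m (res_mod i g *m (res_aug i *m (s *m z)))).
    by rewrite (mulmxA (res_mod i g)) kGhomE !(mulmxA s) sE mul1mx !mulmxA.
  by rewrite szE kGhomE mulmxA.
exists (KGHom hf); congr cohomology_class; apply: val_inj; exact: val_inj.
Qed.

Definition hom_of_class (a : rel_cohomology i N) : kGhom (Omega_n i) N :=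
  sval (cid (class_of_hom_surj a)).

Lemma hom_of_classK a : class_of_hom (hom_of_class a) = a.
Proof. exact: svalP (cid (class_of_hom_surj a)). Qed.

End Represented.

(* Omega^i(g) : Omega^(i+j)(k) -> Omega^i(k) for g : Omega^j(k) -> k *)
Fixpoint Omega_map_n (j : nat) (g : kGhom (Omega_n j) trivial_mod) (i : nat) :
    kGhom (Omega_n (i + j)) (Omega_n i) :=
  match i with
  | 0 => g
  | i'.+1 => Omega_map (Omega_map_n g i')
  end.

(* f o Omega^i(g) for f, g representing a, b. Meaningful for i, j > 0, where it is
   independent of all choices by cupP. *)
Definition cup (i j : nat) (a : rel_cohomology i trivial_mod)
    (b : rel_cohomology j trivial_mod) : rel_cohomology (i + j) trivial_mod :=
  class_of_hom (kGcomp (Omega_map_n (hom_of_class b) i) (hom_of_class a)).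

Lemma is_Omega_mapP M N (f : kGhom M N) : is_Omega_map f (Omega_map f).
Proof. exact: svalP (cid (Omega_map_exists f)). Qed.

Lemma class_of_homSP n N (f g : kGhom (Omega_n n.+1) N) :
  class_of_hom f = class_of_hom g <->
  exists b : kGhom (res_mod n) N, kGhom_mx f - kGhom_mx g = Omega_incl (Omega_n n) *m b.
Proof.
have [_ /row_fullP[w wE] _] := cover_mapP (C (Omega_n n.+1)).
rewrite cohomology_classP; split=> -[b bE]; exists b.
  have {}bE : res_aug n.+1 *m (kGhom_mx f - g) =
              res_aug n.+1 *m (Omega_incl (Omega_n n) *m b).
    have e := congr1 (fun z : kGhom (res_mod n.+1) N => kGhom_mx z) bE.
    by rewrite mulmxBr mulmxA; exact: e.
  by rewrite -[LHS]mul1mx -wE -[LHS]mulmxA bE mulmxA wE mul1mx.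
apply: val_inj; transitivity (res_aug n.+1 *m (kGhom_mx f - g)).
  by rewrite mulmxBr.
by rewrite bE mulmxA.
Qed.

Lemma is_Omega_map_class m n (f f' : kGhom (Omega_n m.+1) (Omega_n n))
    (h h' : kGhom (Omega_n m.+2) (Omega_n n.+1)) :
  class_of_hom f = class_of_hom f' ->
  is_Omega_map f h -> is_Omega_map f' h' -> class_of_hom h = class_of_hom h'.
Proof.
move=> /class_of_homSP[a aE] [b bE hE] [b' bE' hE']; apply/class_of_homSP.
have [pQ _ _] := cover_mapP (C (Omega_n m)).
have [_ _ sN] := cover_mapP (C (Omega_n n)).
have [a' a'E] := rel_projective_lifting pQ sN a.
have [|w wE] := @ker_factor _ _ _ _ _ (res_aug n)
  (b - b' - kGcomp (res_diff m) a').
  rewrite /= !mulmxBl bE bE' -[_ *m a' *m _]mulmxA a'E -mulmxBr aE -!mulmxA.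
  by rewrite subrr.
exists w; apply: (@ker_incl_inj _ _ _ _ _ (res_aug n)).
have e : Omega_incl (Omega_n m.+1) *m (res_aug m.+1 *m Omega_incl (Omega_n m) *m a') = 0.
  by rewrite 2!mulmxA ker_inclK !mul0mx.
transitivity (Omega_incl (Omega_n m.+1) *m (kGhom_mx b - b')).
  by rewrite mulmxBl mulmxBr; congr (_ - _).
rewrite -[RHS]mulmxA [X in _ = _ *m X]wE.
by rewrite -[LHS]subr0 -e -mulmxBr.
Qed.

Lemma cupP i j (f : kGhom (Omega_n i.+1) trivial_mod)
    (h : forall n, kGhom (Omega_n (n + j.+1)) (Omega_n n)) :
  (forall n, is_Omega_map (h n) (h n.+1)) ->
  cup (class_of_hom f) (class_of_hom (h 0%N)) =
  class_of_hom (kGcomp (h i.+1) f).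
Proof.
move=> hh; set f0 := hom_of_class (class_of_hom f).
have f0E : class_of_hom f0 = class_of_hom f by exact: hom_of_classK.
set g := hom_of_class (class_of_hom (h 0%N)).
have gE : class_of_hom g = class_of_hom (h 0%N) by exact: hom_of_classK.
have hE n : class_of_hom (Omega_map_n g n) = class_of_hom (h n).
  elim: n => [//|n IH]; case: n IH => [|n] IH.
    exact: (@is_Omega_map_class j 0 _ _ _ _ IH (is_Omega_mapP _) (hh 0%N)).
  exact: (@is_Omega_map_class (n + j.+1) n.+1 _ _ _ _ IH (is_Omega_mapP _) (hh n.+1)).
have /class_of_homSP[b bE] := hE i.+1.
have /class_of_homSP[c cE] := f0E.
have [k _ kE] := hh i.
apply/class_of_homSP; exists (kGcomp b f0 + kGcomp k c).
rewrite [RHS]mulmxDr [X in _ = X + _]mulmxA -bE [X in _ = _ + X]mulmxA -kE.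
by rewrite -[X in _ = _ + X]mulmxA -cE mulmxBl mulmxBr addrA subrK.
Qed.

End RelativeCohomology.

Definition order2_subgroups (gT : finGroupType) : {set {group gT}} :=
  [set H : {group gT} | #|H| == 2%N].

(* Main.v *)
Require Import Defs.
From mathcomp Require Import all_boot all_order all_algebra all_fingroup.
From mathcomp Require Import all_solvable all_field all_character.
From mathcomp Require Import zify.

Set Implicit Arguments.
Unset Strict Implicit.
Unset Printing Implicit Defensive.

Import GRing.Theory.
Local Open Scope ring_scope.

(** Write x and y for generators of G. The n-th relative syzygy of the trivial
    module is, up to relatively projective summands, the Kronecker module
    P_(2n), where P_m is the sum of a top of dimension m (polynomials in T of
    degree less than m) and a socle of dimension m + 1 (polynomials of degree at
    most m); x - 1 maps the top to the socle by multiplication by 1, and y - 1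
    by multiplication by T.

    If a > b > 0, every composite P_a -> P_b -> k is zero (pencil_mod_hom0):
    on tops, the first map commutes with multiplication by T, so it multiplies
    by the image of 1, and the degree bound forces this image to be 0 because
    the top of P_b is smaller than that of P_a. The first map thus takes values
    in the socle of P_b, which is also its radical, and every map to k kills the
    radical. A cup product of classes of degrees i and j is represented by a
    composite Omega^(i+j)(k) -> Omega^i(k) -> k, hence, after identifying the
    syzygies with P_(2i+2j) and P_(2i), by zero.

    The identification rests on chi-split exact sequences
    0 -> P_(m+2) -> Q -> P_m -> 0, where Q is the sum of a free module of rank m
    and of the three modules k[G/H]. The free part covers the top of P_m. On
    restriction to a subgroup H of order 2, P_m is the sum of a free module and
    of one trivial summand, and k[G/H] provides a lift of the latter
    (pencil_cover_split). The kernel is found by interpolation: the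
    three subgroups correspond to the points oo, 0 and 1 of the projective line,
    and a polynomial is determined by its values at these points together with
    its quotient by T(T + 1) (syzygy_identity, suffix_ker).

    The relative covers of the statement are arbitrary, so their syzygies are
    only compared with the P_(2n) by chain maps in both directions, whose
    composite is the identity up to maps that extend to a cover (comparison);
    such maps represent the zero class, which is enough (cup_eq0). *)

(** * Comparison of relative resolutions *)

Section StableComparison.
Variables (F : fieldType) (gT : finGroupType) (chi : {set {group gT}}).
Variable C : forall M : kGmod F gT, rel_cover chi M.
Implicit Types M N : kGmod F gT.

Lemma kGid_subproof M : 1%:M \in repr_hom [set: gT] M M.
Proof. by apply: kGhom_intro => g; rewrite mulmx1 mul1mx. Qed.

Definition kGid M : kGhom M M := KGHom (kGid_subproof M).

(** Asking for the lifting property, rather than for the middle module to be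
    relatively projective, lets the middle module be built from pieces, by lifting_dadd. *)
Definition factors_through_lifting M N (f : kGhom M N) : Prop :=
  exists (Q : kGmod F gT) (a : kGhom M Q) (b : kGhom Q N),
    lifting chi Q /\ a *m b = f.

(** A homotopy: if f = a b through Q, then b lifts to b' : Q -> cover of N, and
    a lift of f to the covers differs from the lift through Q by a map into the
    kernel of the cover of N; on the syzygy of M, the lift through Q vanishes. *)
Lemma is_Omega_map_null M N (f : kGhom M N) (h : kGhom (Omega C M) (Omega C N)) :
  factors_through_lifting f -> is_Omega_map f h ->
  exists w : kGhom (cover_mod (C M)) (Omega C N), Omega_incl C M *m w = h.
Proof.
move=> [Q [a [b [lQ abE]]]] [fb fbE hE].
have [_ _ sN] := cover_mapP (C N); have [b' b'E] := lQ _ _ _ sN b.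
have [|w wE] := @ker_factor _ _ _ _ _ (cover_map (C N))
    (fb - kGcomp (kGcomp (cover_map (C M)) a) b').
  by rewrite /= mulmxBl fbE -!mulmxA b'E abE subrr.
exists w; apply: (@ker_incl_inj _ _ _ _ _ (cover_map (C N))).
rewrite [RHS]hE -mulmxA wE /= mulmxBr !mulmxA.
by rewrite [X in X *m a]ker_inclK !mul0mx subr0.
Qed.

(* From here on, the sequences 0 -> P (n+1) -> Q n -> P n -> 0 form another
   relative resolution of the trivial module. *)
Variables (P Q : nat -> kGmod F gT).
Variables (p : forall n, kGhom (Q n) (P n)) (e : forall n, kGhom (P n.+1) (Q n)).
Hypothesis Q_lifting : forall n, lifting chi (Q n).
Hypothesis p_split : forall n, chi_split chi (p n).
Hypothesis e_inj : forall n, row_free (e n).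
Hypothesis ep_exact : forall n, (e n :=: kermx (p n))%MS.

Lemma syzygy_factor M n (f : kGhom M (Q n)) :
  f *m p n = 0 -> exists h : kGhom M (P n.+1), h *m e n = f.
Proof.
move=> fp0; have /submxP[D fE] : (f <= e n)%MS by rewrite ep_exact; apply/sub_kermxP.
have hD : D \in repr_hom [set: gT] M (P n.+1).
  apply: kGhom_intro => g; apply: (row_free_inj (e_inj n)).
  by rewrite -!mulmxA kGhomE -fE kGhomE fE mulmxA.
by exists (KGHom hD).
Qed.

Hypotheses (phi0 : kGhom trivial_mod (P 0)) (psi0 : kGhom (P 0) trivial_mod).
Hypothesis phi0K : phi0 *m psi0 = 1%:M.

(** The composite Omega^n -> P n -> Omega^n is the identity up to stably trivial
    maps. This is what it takes
    to route maps between syzygies through the P n. *)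
Definition stable_retract n (phi : kGhom (Omega_n C n) (P n)) psi : Prop :=
  factors_through_lifting (kGcomp phi psi - kGid (Omega_n C n)).

(** Lifting phi and psi to the middle terms and restricting to the kernels gives
    phi' and psi'. Since phi' psi' - 1 is then a syzygy map of phi psi - 1, it
    extends to the cover; this form of the error term, more precise than stable
    triviality, is the one that represents the zero class. *)
Lemma comparison_step n phi psi : @stable_retract n phi psi ->
  exists (phi' : kGhom (Omega_n C n.+1) (P n.+1)) (psi' : kGhom (P n.+1) (Omega_n C n.+1))
    (w : kGhom (res_mod C n) (Omega_n C n.+1)),
    Omega_incl C (Omega_n C n) *m w = phi' *m psi' - 1%:M.
Proof.
move=> hn.
have [pC _ sC] := cover_mapP (C (Omega_n C n)).
have [b bE] := rel_projective_lifting pC (@p_split n) (kGcomp (res_aug C n) phi).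
have [c cE] := Q_lifting sC (kGcomp (p n) psi).
have [|phi' phi'E] := @syzygy_factor _ n (kGcomp (Omega_incl C (Omega_n C n)) b).
  by rewrite /= -mulmxA bE /= mulmxA ker_inclK mul0mx.
have epE : e n *m p n = 0 by apply/sub_kermxP; rewrite ep_exact.
have [|psi' psi'E] := @ker_factor _ _ _ _ _ (res_aug C n) (kGcomp (e n) c).
  by rewrite /= -mulmxA cE /= mulmxA epE mul0mx.
pose h := kGcomp phi' psi' - kGid (Omega_n C n.+1).
have [|w wE] := @is_Omega_map_null _ _ _ h hn; last by exists phi', psi', w.
exists (kGcomp b c - kGid _).
  by rewrite /= mulmxBl mulmxBr -mulmxA cE /= mulmxA bE /= -mulmxA mul1mx mulmx1.
rewrite /= mulmxBl mulmxBr mul1mx mulmx1 -mulmxA psi'E /= mulmxA phi'E /=.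
by rewrite -mulmxA.
Qed.

Lemma comparison n : exists phi psi, @stable_retract n phi psi.
Proof.
elim: n => [|n [phi [psi /comparison_step[phi' [psi' [w wE]]]]]].
  exists phi0, psi0, grepr0, 0, 0; split; first exact: lifting0.
  by rewrite /= mulmx0 phi0K subrr.
have [pC _ _] := cover_mapP (C (Omega_n C n)).
exists phi', psi', (res_mod C n), (Omega_incl C (Omega_n C n)), w; split=> //.
exact: rel_projective_lifting.
Qed.

Lemma class_of_hom_null n N (f : kGhom (Omega_n C n.+1) N)
    (b : kGhom (res_mod C n) N) :
  kGhom_mx f = Omega_incl C (Omega_n C n) *m b -> class_of_hom f = 0.
Proof.
move=> fE; transitivity (class_of_hom (0 : kGhom (Omega_n C n.+1) N)).
  by apply/class_of_homSP; exists b; rewrite -fE subr0.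
transitivity (cohomology_class (0 : cocycle (res_diff C) N n.+1)).
  by apply/cohomology_classP; exists 0; apply: val_inj; rewrite /= !mulmx0 subr0.
by rewrite /cohomology_class generic_quotient.piE.
Qed.

Hypothesis P_vanish : forall i j (h : kGhom (P (i.+1 + j.+1)) (P i.+1))
  (f : kGhom (P i.+1) trivial_mod), h *m f = 0.

(** With phi1, psi1 in degree i + 1 and phi2, psi2 in degree (i + 1) + (j + 1),
    f and h are replaced by psi1 f and psi2 h phi1. Both error terms extend to
    the cover res_mod (i + j + 1): the one of phi2 psi2 directly, the one of
    phi1 psi1 because h is a syzygy map and so transports Omega_incl. *)
Lemma cup_eq0 i j (a : rel_cohomology C i.+1 trivial_mod)
  (b : rel_cohomology C j.+1 trivial_mod) : cup a b = 0.
Proof.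
rewrite /cup; set f := hom_of_class a; set g := hom_of_class b.
set h := Omega_map_n g i.+1.
have [fb _ hE] := is_Omega_mapP C (Omega_map_n g i).
have [phi [psi /comparison_step[phi1 [psi1 [w wE]]]]] := comparison i.
have [phi' [psi' /comparison_step[phi2 [psi2 [w' w'E]]]]] := comparison (i + j.+1).
have v0 := P_vanish (kGcomp (kGcomp psi2 h) phi1) (kGcomp psi1 f).
pose hp := kGcomp (kGcomp (kGcomp h phi1) psi1) f.
set I := Omega_incl C (Omega_n C i) in hE wE.
set I' := Omega_incl C (Omega_n C (i + j.+1)) in hE w'E.
have hpE : kGhom_mx hp = - (I' *m (w' *m hp)).
  rewrite mulmxA w'E mulmxBl mul1mx opprB -mulmxA.
  have -> : psi2 *m hp = 0 by rewrite /hp /= !mulmxA -mulmxA; exact: v0.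
  by rewrite mulmx0 subr0.
have hfE : kGhom_mx hp = h *m f + I' *m (fb *m (w *m f)).
  rewrite [LHS]/= -(mulmxA h phi1) -[phi1 *m psi1](subrK 1%:M) -wE.
  rewrite mulmxDr mulmxDl mulmx1 addrC (mulmxA h I) [h *m I]hE.
  by rewrite -(mulmxA I' fb) -!(mulmxA I') -(mulmxA fb).
apply: (@class_of_hom_null _ _ _ (- (kGcomp w' hp + kGcomp (kGcomp fb w) f))).
rewrite [LHS]/= -[LHS](addrK (I' *m (fb *m (w *m f)))) -hfE hpE.
by rewrite /= mulmxN mulmxDr opprD !mulmxA.
Qed.
End StableComparison.

(** * Extensions and direct sums *)

Section ExtensionModule.
Variables (F : fieldType) (gT : finGroupType).
Variables (a b : nat) (L : gT -> 'M[F]_(a, b)).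
Hypothesis L_add : forall g h, L (g * h)%g = L g + L h.

Lemma ext_mx_repr :
  mx_repr [set: gT] (fun g => block_mx 1%:M (L g) 0 1%:M : 'M_(a + b)).
Proof.
split=> [|g h _ _]; last first.
  by rewrite mulmx_block !mulmx1 !mul1mx !mulmx0 !mul0mx !addr0 !add0r L_add addrC.
have L1 : L 1%g = 0 by apply: (addrI (L 1%g)); rewrite -L_add mulg1 addr0.
by rewrite L1 -scalar_mx_block.
Qed.

Definition ext_mod : kGmod F gT :=
  @Representation _ _ [set: gT]%G _ (MxRepresentation ext_mx_repr).
End ExtensionModule.

Lemma mulmx_reprM (F : fieldType) (gT : finGroupType) (N : kGmod F gT) m
    (A : 'M_(m, rdegree N)) g h : A *m N g *m N h = A *m N (g * h)%g.
Proof. by rewrite (repr_mxM N (in_setT g) (in_setT h)) mulmxA. Qed.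

Lemma repr_mulmxM (F : fieldType) (gT : finGroupType) (N : kGmod F gT) m
    (A : 'M_(rdegree N, m)) g h : N g *m (N h *m A) = N (g * h)%g *m A.
Proof. by rewrite (repr_mxM N (in_setT g) (in_setT h)) mulmxA. Qed.

Section DaddRow.
Variables (F : fieldType) (gT : finGroupType) (M N1 N2 : kGmod F gT).
Variables (u : kGhom M N1) (v : kGhom M N2).

Lemma dadd_row_subproof : (row_mx u v : 'M_(_, rdegree (dadd_grepr N1 N2)))
  \in repr_hom [set: gT] M (dadd_grepr N1 N2).
Proof.
apply: kGhom_intro => g.
by rewrite /= mul_row_block !mulmx0 addr0 add0r -!kGhomE mul_mx_row.
Qed.

Definition dadd_row : kGhom M (dadd_grepr N1 N2) := KGHom dadd_row_subproof.
End DaddRow.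

Lemma dadd_row_col (F : fieldType) (gT : finGroupType) (M N1 N2 N : kGmod F gT)
    (u : kGhom M N1) (v : kGhom M N2) (u' : kGhom N1 N) (v' : kGhom N2 N) :
  dadd_row u v *m dadd_col u' v' = u *m u' + v *m v'.
Proof. exact: mul_row_col. Qed.

Lemma dadd_row_fix (F : fieldType) (gT : finGroupType) (M N : kGmod F gT) n
    (u : 'M_(n, rdegree M)) (v : 'M_(n, rdegree N)) g :
  u *m M g = u -> v *m N g = v ->
  (row_mx u v : 'M_(n, rdegree (dadd_grepr M N))) *m dadd_grepr M N g = row_mx u v.
Proof.
by move=> uM vN; rewrite /= mul_row_block uM vN !mulmx0 addr0 add0r.
Qed.

(** * Permutation modules on two cosets *)

Lemma mem_index2 (gT : finGroupType) (H : {group gT}) g h :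
  #|[set: gT] : H|%g = 2%N -> (g * h \in H)%g = ((g \in H) == (h \in H)).
Proof.
move=> iH; have [gH|gH] := boolP (g \in H); first by rewrite groupMl.
have [hH|hH] := boolP (h \in H); first by rewrite groupMr // (negPf gH).
have : (h^-1 \in H :* g)%g.
  by rewrite (rcoset_index2 (subsetT H) iH) !inE ?groupV ?gH ?hH.
by rewrite mem_rcoset -invMg groupV.
Qed.

Section CosetModule.
Variables (F : fieldType) (gT : finGroupType) (H : {group gT}) (z : gT).
Hypothesis F_char2 : 2%N \in [pchar F].
Hypothesis H_index : #|[set: gT] : H|%g = 2%N.
Hypothesis zH : z \notin H.

Lemma mx_oppr2 m n (A : 'M[F]_(m, n)) : - A = A.
Proof. by rewrite -scaleN1r oppr_pchar2 // scale1r. Qed.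

Lemma mx_addrr2 m n (A : 'M[F]_(m, n)) : A + A = 0.
Proof. by rewrite -{1}[A]mx_oppr2 addNr. Qed.

Definition coset_char (g : gT) : F := (g \notin H)%:R.

Lemma coset_charM g h : coset_char (g * h)%g = coset_char g + coset_char h.
Proof.
rewrite /coset_char mem_index2 //.
case: (g \in H).
  by case: (h \in H); rewrite ?addr0 ?add0r ?addrr_pchar2.
by case: (h \in H); rewrite ?addr0 ?add0r ?addrr_pchar2.
Qed.

Lemma coset_cocycle g h :
  (coset_char (g * h)%g)%:M = (coset_char g)%:M + (coset_char h)%:M :> 'M[F]_1.
Proof. by apply/matrixP=> i j; rewrite !mxE coset_charM mulrnDl. Qed.

(** The module k[G/H], in the basis H, Hz - H, where z is any element outside H.
    In characteristic 2 the matrices do not depend on z. *)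
Definition coset_mod : kGmod F gT := ext_mod coset_cocycle.

Section HomOut.
Variables (N : kGmod F gT) (v : 'rV[F]_(rdegree N)).
Hypothesis v_fix : forall h, h \in H -> v *m N h = v.

(** An H-fixed vector has only two translates, one for each coset of H. *)
Lemma fixed_translate g : v *m N g = v + coset_char g *: (v *m N z - v).
Proof.
rewrite /coset_char; have [gH|gH] := boolP (g \in H).
  by rewrite v_fix // scale0r addr0.
have gzH : (g * z^-1 \in H)%g.
  by rewrite mem_index2 // groupV (negPf gH) (negPf zH).
by rewrite -[g in LHS](mulgKV z) -mulmx_reprM (v_fix gzH) scale1r addrC subrK.
Qed.

(** Frobenius reciprocity: a map from k[G/H] is an H-fixed vector, the image of
    the coset H. *)
Lemma coset_hom_subproof :
  (col_mx v (v *m N z - v) : 'M_(rdegree coset_mod, _))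
    \in repr_hom [set: gT] coset_mod N.
Proof.
apply: kGhom_intro => g; rewrite /= mul_block_col mul_col_mx !mul1mx mul0mx add0r.
rewrite mul_scalar_mx -fixed_translate; congr col_mx.
rewrite mulmxBl mulmx_reprM (fixed_translate (_ * _)%g) (fixed_translate g).
rewrite coset_charM.
by rewrite scalerDl {1}/coset_char zH scale1r (addrCA v) addrK.
Qed.

Definition coset_hom : kGhom coset_mod N := KGHom coset_hom_subproof.
End HomOut.

Lemma coset_homE (N : kGmod F gT) (f : kGhom coset_mod N) :
  (forall h, h \in H -> usubmx f *m N h = usubmx f) /\
  kGhom_mx f = col_mx (usubmx f) (usubmx f *m N z - usubmx f).
Proof.
have fE g : usubmx f *m N g = usubmx f + coset_char g *: dsubmx f.
  have fgE := kGhomE f g; rewrite -[kGhom_mx f]vsubmxK in fgE.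
  rewrite /= mul_block_col mul_col_mx mul1mx mul_scalar_mx in fgE.
  by case/eq_col_mx: fgE.
split=> [h hH|]; first by rewrite fE /coset_char hH scale0r addr0.
by rewrite fE /coset_char zH scale1r addrC addKr vsubmxK.
Qed.

(** An H-equivariant section of p carries the H-fixed vector that represents a
    map from k[G/H] to a fixed vector above it. *)
Lemma lifting_coset_mod (chi : {set {group gT}}) :
  H \in chi -> lifting chi coset_mod.
Proof.
move=> Hchi X N p /(_ H Hchi)[w /repr_homP w_hom wp] f.
have [v_fix fE] := coset_homE f.
have vw_fix h : h \in H -> usubmx f *m w *m X h = usubmx f *m w.
  by move=> hH; rewrite -mulmxA -w_hom // mulmxA v_fix.
have wpE : usubmx f *m w *m p = usubmx f by rewrite -mulmxA wp mulmx1.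
exists (coset_hom vw_fix).
by rewrite [RHS]fE [LHS]mul_col_mx mulmxBl -[_ *m X z *m p]mulmxA kGhomE mulmxA wpE.
Qed.

Section HomIn.
Variables (M : kGmod F gT) (D : 'cV[F]_(rdegree M)).
Hypothesis D_fix : forall h, h \in H -> M h *m D = D.

Lemma cofixed_translate g : M g *m D = D + coset_char g *: (M z *m D - D).
Proof.
rewrite /coset_char; have [gH|gH] := boolP (g \in H).
  by rewrite D_fix // scale0r addr0.
have zgH : (z^-1 * g \in H)%g.
  by rewrite mem_index2 // groupV (negPf gH) (negPf zH).
by rewrite -[g in LHS](mulKVg z) -repr_mulmxM (D_fix zgH) scale1r addrC subrK.
Qed.

(** The dual reciprocity: a map to k[G/H] is an H-invariant linear form D, the
    coordinate on Hz - H, and invariance forces the other coordinate. *)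
Lemma coset_cohom_subproof :
  (row_mx (M z *m D - D) D : 'M_(_, rdegree coset_mod))
    \in repr_hom [set: gT] M coset_mod.
Proof.
apply: kGhom_intro => g; rewrite /= mul_row_block mul_mx_row !mulmx1 mulmx0 addr0.
rewrite mul_mx_scalar [_ *: _ + D]addrC -cofixed_translate; congr row_mx.
rewrite mulmxBr repr_mulmxM (cofixed_translate (_ * _)%g) (cofixed_translate g).
rewrite coset_charM.
by rewrite scalerDl {2}/coset_char zH scale1r addrA [_ + (_ - _)]addrC addrK.
Qed.

Definition coset_cohom : kGhom M coset_mod := KGHom coset_cohom_subproof.
End HomIn.

Lemma coset_cohom_hom (M N : kGmod F gT) (D : 'cV_(rdegree M)) (v : 'rV_(rdegree N))
    (D_fix : forall h, h \in H -> M h *m D = D)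
    (v_fix : forall h, h \in H -> v *m N h = v) :
  coset_cohom D_fix *m coset_hom v_fix = (M z *m D - D) *m v + D *m (v *m N z - v).
Proof. exact: mul_row_col. Qed.
End CosetModule.

(** * Matrices that skip a coordinate *)

Section SkipMatrix.
Variable F : fieldType.

(** In the bases of powers of T, polynomials of degree less than m are sent to
    polynomials of degree at most m by multiplication by 1 if p = ord_max, and
    by multiplication by T if p = ord0. *)
Definition skip_mx m (p : 'I_m.+1) : 'M[F]_(m, m.+1) :=
  \matrix_(i, j) (lift p i == j)%:R.

Lemma skip_mxE m (p : 'I_m.+1) n (A : 'M[F]_(m.+1, n)) i j :
  (skip_mx p *m A) i j = A (lift p i) j.
Proof.
rewrite !mxE (bigD1 (lift p i)) //= big1 => [|k /negPf kp].
  by rewrite !mxE eqxx mul1r addr0.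
by rewrite !mxE eq_sym kp mul0r.
Qed.

Lemma mul_skip_mx_lift m (p : 'I_m.+1) n (A : 'M[F]_(n, m)) i k :
  (A *m skip_mx p) i (lift p k) = A i k.
Proof.
rewrite !mxE (bigD1 k) //= big1 => [|l /negPf lk].
  by rewrite !mxE eqxx mulr1 addr0.
by rewrite !mxE (inj_eq lift_inj) lk mulr0.
Qed.

Lemma mul_skip_mx0 m (p : 'I_m.+1) n (A : 'M[F]_(n, m)) i :
  (A *m skip_mx p) i p = 0.
Proof.
rewrite !mxE big1 // => k _.
by rewrite !mxE eq_sym (negPf (neq_lift _ _)) mulr0.
Qed.

(** The rows of skip_mx p are the basis vectors other than the p-th. *)
Lemma skip_mx_row_inj m (p : 'I_m.+1) n (A : 'M[F]_(m.+1, n)) :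
  skip_mx p *m A = 0 -> delta_mx (0 : 'I_1) p *m A = 0 -> A = 0.
Proof.
move=> Ap rp; apply/matrixP=> i j; rewrite [RHS]mxE.
have [k ->|->] := unliftP p i; first by rewrite -skip_mxE Ap mxE.
by move/matrixP: rp => /(_ 0 j); rewrite -rowE !mxE.
Qed.

(** Consecutive rows of A are opposite, and the first one is zero. *)
Lemma skip_mx_add_inj m n (A : 'M[F]_(m.+1, n)) :
  (skip_mx ord_max + skip_mx ord0) *m A = 0 ->
  delta_mx (0 : 'I_1) ord0 *m A = 0 -> A = 0.
Proof.
move=> As r0; apply/matrixP=> i j; rewrite [RHS]mxE.
have A0 : A ord0 j = 0 by move/matrixP: r0 => /(_ 0 j); rewrite -rowE !mxE.
rewrite -[i]inord_val; case: i => i /=; elim: i => [|i IH] im.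
  by rewrite -[RHS]A0; congr (A _ j); apply: ord_inj; rewrite inordK.
have im' : (i < m)%N := im.
move/matrixP: As => /(_ (Ordinal im') j).
have -> : inord i.+1 = lift ord0 (Ordinal im').
  by apply: ord_inj; rewrite inordK ?lift0.
rewrite mulmxDl mxE !skip_mxE mxE.
have -> : lift ord_max (Ordinal im') = inord i.
  by apply: ord_inj; rewrite lift_max inordK // ltnW.
by rewrite IH ?add0r // ltnW.
Qed.

Lemma skip_mx_inj m n (A : 'M[F]_(m.+1, n)) : (0 < m)%N ->
  skip_mx ord_max *m A = 0 -> skip_mx ord0 *m A = 0 -> A = 0.
Proof.
move=> m_gt0 Amax A0; apply/matrixP=> i j; rewrite [RHS]mxE.
have [k ->|->] := unliftP ord_max i; first by rewrite -skip_mxE Amax mxE.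
have [k ->|/(congr1 val)/= m0] := unliftP ord0 (@ord_max m).
  by rewrite -skip_mxE A0 mxE.
by rewrite m0 in m_gt0.
Qed.
End SkipMatrix.

(** * Splitting over a subgroup of order two *)

Lemma row_full_ker (F : fieldType) m n (A : 'M[F]_(m, n)) :
  (forall u : 'M[F]_n, A *m u = 0 -> u = 0) -> row_full A.
Proof. by move=> A0; rewrite -cokermx_eq0; apply/eqP/A0/mulmx_coker. Qed.

Lemma row_free_ker (F : fieldType) m n (A : 'M[F]_(m, n)) :
  (forall u : 'M[F]_m, u *m A = 0 -> u = 0) -> row_free A.
Proof. by move=> A0; rewrite -kermx_eq0; apply/eqP/A0/mulmx_ker. Qed.

Section SplitInvolution.
Variables (F : fieldType) (gT : finGroupType) (M Q : kGmod F gT).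
Variables (f : kGhom Q M) (h : gT).
Hypothesis h_order : #[h]%g = 2%N.

(** If the images of A, their translates by h, and the images of the fixed vectors
    v form a basis of M, then over <[h]> the module M is free on the first plus
    trivial on the last, and sending this basis back to A, its translates and v
    is a section of f. The condition on dimensions says that this full family is
    a basis. *)
Lemma splits_involution a b (A : 'M_(a, rdegree Q)) (v : 'M_(b, rdegree Q)) :
  v *m Q h = v -> (a + (a + b) = rdegree M)%N ->
  row_full (col_mx (A *m f) (col_mx (A *m f *m M h) (v *m f))) ->
  splits_on <[h]>%G f.
Proof.
move=> v_fix degM; set B := col_mx _ _ => Bfull.
have Bfree : row_free B by rewrite /row_free (eqP Bfull) degM.
have [B' B'B] := row_fullP Bfull; have [B'' BB''] := row_freeP Bfree.
have BB' : B *m B' = 1%:M.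
  by rewrite -[B' in LHS]mulmx1 -BB'' (mulmxA B') B'B mul1mx.
pose swap : 'M[F]_(a + (a + b)) := col_mx (row_mx 0 (row_mx 1%:M 0))
  (col_mx (row_mx 1%:M 0) (row_mx 0 (row_mx 0 1%:M))).
have swapE n (u1 u2 : 'M[F]_(a, n)) (u3 : 'M_(b, n)) :
    swap *m col_mx u1 (col_mx u2 u3) = col_mx u2 (col_mx u1 u3).
  by rewrite !mul_col_mx !mul_row_col !mul0mx !mul1mx !add0r !addr0.
have hh : (h * h = 1)%g by rewrite -[(h * h)%g]/(h ^+ 2)%g -h_order expg_order.
pose Bt := col_mx A (col_mx (A *m Q h) v).
have Bt_h : Bt *m Q h = swap *m Bt.
  by rewrite /Bt swapE !mul_col_mx v_fix mulmx_reprM hh repr_mx1 mulmx1.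
have B_h : B *m M h = swap *m B.
  rewrite /B swapE !mul_col_mx mulmx_reprM hh repr_mx1 mulmx1.
  by rewrite -[v *m f *m M h]mulmxA -kGhomE mulmxA v_fix.
have Bt_f : Bt *m f = B.
  by rewrite /Bt /B !mul_col_mx -[_ *m Q h *m f]mulmxA kGhomE mulmxA.
exists (B' *m Bt); last by rewrite -mulmxA Bt_f.
apply/repr_homP => g; rewrite /= cycle2g // !inE => /orP[]/eqP->.
  by rewrite !repr_mx1 mulmx1 mul1mx.
have B'_h : M h *m B' = B' *m swap.
  have -> : M h = B' *m swap *m B by rewrite -mulmxA -B_h mulmxA B'B mul1mx.
  by rewrite -(mulmxA _ B) BB' mulmx1.
by rewrite mulmxA B'_h -!mulmxA Bt_h.
Qed.
End SplitInvolution.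

(** * The Klein four-group *)

Section KleinFour.
Variables (F : fieldType) (gT : finGroupType) (x y : gT).
Hypothesis F_char2 : 2%N \in [pchar F].
Hypothesis G_elementary : (2.-abelem [set: gT])%g.
Hypothesis G_order : #|gT| = 4%N.
Hypothesis x_neq1 : x != 1%g.
Hypothesis y_notin : y \notin <[x]>%g.

Lemma klein_sqr (g : gT) : (g * g = 1)%g.
Proof.
by have /abelemP[//|_ /(_ g (in_setT g))] := G_elementary; rewrite expgS expg1.
Qed.

Lemma klein_comm (g h : gT) : (g * h = h * g)%g.
Proof.
have /abelemP[//|/centsP cG _] := G_elementary.
by apply: cG; rewrite inE.
Qed.

Lemma klein_order (g : gT) : g != 1%g -> #[g]%g = 2%N.
Proof. by apply: nt_prime_order; rewrite // expgS expg1 klein_sqr. Qed.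

Lemma klein_cycle (g : gT) : g != 1%g -> <[g]>%g = [set 1%g; g].
Proof. by move/klein_order/cycle2g. Qed.

Lemma klein_index (g : gT) : g != 1%g -> #|[set: gT] : <[g]>|%g = 2%N.
Proof.
move=> g1; rewrite -divgS ?subsetT //= cardsT G_order klein_cycle // cards2.
by rewrite eq_sym g1.
Qed.

Lemma y_neq1 : y != 1%g.
Proof. by apply: contraNneq y_notin => ->; rewrite group1. Qed.

Lemma y_neqx : y != x.
Proof. by apply: contraNneq y_notin => ->; rewrite cycle_id. Qed.

Lemma xy_neq1 : (x * y != 1)%g.
Proof.
apply: contraNneq y_neqx => xy1; apply/eqP/(mulgI x).
by rewrite xy1 klein_sqr.
Qed.

Lemma klein_ind (P : gT -> Prop) :
  P 1%g -> P x -> P y -> P (x * y)%g -> forall g, P g.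
Proof.
move=> P1 Px Py Pxy g; have [gX|gX] := boolP (g \in <[x]>%g).
  by move: gX; rewrite klein_cycle // !inE => /orP[]/eqP->.
have : (g * y \in <[x]>)%g.
  by rewrite (mem_index2 _ _ (klein_index x_neq1)) (negPf gX) (negPf y_notin).
rewrite klein_cycle // !inE.
by case/orP=> /eqP gyE; rewrite -[g]mulg1 -(klein_sqr y) mulgA gyE ?mul1g.
Qed.

Lemma klein_order2_subgroups (H : {group gT}) : H \in order2_subgroups gT ->
  [\/ H = <[x]>%G, H = <[y]>%G | H = <[x * y]>%G].
Proof.
rewrite inE => /eqP cH; have /cyclicP[h Hh] : cyclic H by rewrite prime_cyclic ?cH.
have HE : H = <[h]>%G by exact: val_inj.
have : h != 1%g by apply: contra_eq_neq cH => h1; rewrite HE h1 /= cycle1 cards1.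
rewrite {}HE {Hh}; elim/klein_ind: h; first by rewrite eqxx.
- by constructor 1.
- by constructor 2.
- by constructor 3.
Qed.

Lemma cycle_order2 (g : gT) : g != 1%g -> <[g]>%G \in order2_subgroups gT.
Proof. by move=> g1; rewrite inE /= klein_cycle // cards2 (eq_sym _ g) g1. Qed.

Lemma x_notin_y : x \notin <[y]>%g.
Proof.
by rewrite klein_cycle ?y_neq1 // !inE (negPf x_neq1) eq_sym (negPf y_neqx).
Qed.

Lemma x_notin_xy : x \notin <[x * y]>%g.
Proof.
rewrite klein_cycle ?xy_neq1 // !inE (negPf x_neq1) /=.
by apply: contraNneq y_neq1 => e; rewrite -(mulKg x y) -e mulVg.
Qed.

Lemma y_index : #|[set: gT] : <[y]>|%g = 2%N.
Proof. exact: klein_index y_neq1. Qed.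

Lemma x_index : #|[set: gT] : <[x]>|%g = 2%N.
Proof. exact: klein_index x_neq1. Qed.

Lemma xy_index : #|[set: gT] : <[x * y]>|%g = 2%N.
Proof. exact: klein_index xy_neq1. Qed.

(** Every g is a product of powers of x and y, whose exponents modulo 2 are
    xchar g and ychar g; these are the characters with kernels <[y]> and <[x]>. *)
Definition xchar : gT -> F := coset_char F <[y]>%G.
Definition ychar : gT -> F := coset_char F <[x]>%G.

Lemma xchar_x : xchar x = 1.
Proof. by rewrite /xchar /coset_char x_notin_y. Qed.
Lemma xchar_y : xchar y = 0.
Proof. by rewrite /xchar /coset_char cycle_id. Qed.
Lemma ychar_x : ychar x = 0.
Proof. by rewrite /ychar /coset_char cycle_id. Qed.
Lemma ychar_y : ychar y = 1.
Proof. by rewrite /ychar /coset_char y_notin. Qed.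
Lemma xcharM g h : xchar (g * h)%g = xchar g + xchar h.
Proof. exact: coset_charM F_char2 y_index g h. Qed.
Lemma ycharM g h : ychar (g * h)%g = ychar g + ychar h.
Proof. exact: coset_charM F_char2 x_index g h. Qed.

Lemma kGhom_gen (M N : kGmod F gT) (f : 'M_(rdegree M, rdegree N)) :
  M x *m f = f *m N x -> M y *m f = f *m N y -> f \in repr_hom [set: gT] M N.
Proof.
move=> fx fy; apply: kGhom_intro; apply: klein_ind => //.
  by rewrite !repr_mx1 mulmx1 mul1mx.
by rewrite -repr_mulmxM fy mulmxA fx mulmx_reprM.
Qed.

Lemma repr_sqr (N : kGmod F gT) m (A : 'M_(m, rdegree N)) g : A *m N g *m N g = A.
Proof. by rewrite mulmx_reprM klein_sqr repr_mx1 mulmx1. Qed.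

Lemma sqr_repr (N : kGmod F gT) m (A : 'M_(rdegree N, m)) g : N g *m (N g *m A) = A.
Proof. by rewrite repr_mulmxM klein_sqr repr_mx1 mul1mx. Qed.

Lemma mx_subrC2 p q (A B : 'M[F]_(p, q)) : A - B = B - A.
Proof. by rewrite -[RHS]opprB [RHS]mx_oppr2. Qed.

(** * Free modules *)

Section Free.
Variable m : nat.

(** The action on the vectors e and e (x - 1), for m generators e, of the power of
    x that occurs in g. *)
Definition free_block (g : gT) : 'M[F]_(m + m) := block_mx 1%:M (xchar g)%:M 0 1%:M.

Lemma free_blockM g h : free_block (g * h)%g = free_block g *m free_block h.
Proof.
rewrite /free_block mulmx_block !mulmx1 !mul1mx !mulmx0 !mul0mx !addr0 !add0r.
by rewrite xcharM addrC; congr block_mx; apply/matrixP=> i j; rewrite !mxE mulrnDl.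
Qed.

(** The free module on m generators e, in the basis e, e (x - 1), e (y - 1),
    e (y - 1) (x - 1), where each entry stands for a block of m vectors. *)
Lemma free_mx_repr : mx_repr [set: gT] (fun g =>
  block_mx (free_block g) (ychar g *: free_block g) 0 (free_block g) : 'M_(m + m + (m + m))).
Proof.
split=> [|g h _ _].
  rewrite /free_block /xchar /ychar /coset_char !group1 scale0r.
  by rewrite raddf0 -!scalar_mx_block.
rewrite mulmx_block !mulmx0 !mul0mx !addr0 !add0r -!scalemxAr -!scalemxAl.
by rewrite -free_blockM ycharM scalerDl addrC.
Qed.

Definition free_mod : kGmod F gT :=
  @Representation _ _ [set: gT]%G _ (MxRepresentation free_mx_repr).

Lemma free_block_x : free_block x = block_mx 1%:M 1%:M 0 1%:M.
Proof. by rewrite /free_block xchar_x. Qed.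

Lemma free_block_y : free_block y = 1%:M.
Proof. by rewrite /free_block xchar_y raddf0 -scalar_mx_block. Qed.

Section Out.
Variables (N : kGmod F gT) (A : 'M[F]_(m, rdegree N)).
Let Ay := A *m N y - A.

(** A lists the images of the generators; those of the other basis vectors follow. *)
Definition free_hom_mx : 'M_(m + m + (m + m), rdegree N) :=
  col_mx (col_mx A (A *m N x - A)) (col_mx Ay (Ay *m N x - Ay)).

Lemma free_hom_subproof : (free_hom_mx : 'M_(rdegree free_mod, _))
  \in repr_hom [set: gT] free_mod N.
Proof.
have colE (B : 'M[F]_(m, rdegree N)) :
    free_block x *m col_mx B (B *m N x - B) = col_mx B (B *m N x - B) *m N x.
  rewrite free_block_x mul_block_col mul_col_mx !mul1mx mul0mx add0r addrC subrK.
  by rewrite mulmxBl repr_sqr mx_subrC2.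
have AyE : Ay *m N y = Ay by rewrite /Ay mulmxBl repr_sqr mx_subrC2.
have dyE (B : 'M[F]_(m, rdegree N)) :
    (B *m N x - B) *m N y = B *m N y *m N x - B *m N y.
  by rewrite mulmxBl !mulmx_reprM klein_comm.
have AyD : A *m N y = A + Ay by rewrite addrC subrK.
rewrite /free_hom_mx; move: (Ay) AyE AyD => B BE AE.
apply: kGhom_gen; rewrite /= mul_block_col [RHS]mul_col_mx.
  by rewrite ychar_x scale0r !mul0mx addr0 add0r !colE.
rewrite ychar_y scale1r free_block_y !mul1mx mul0mx add0r !mul_col_mx add_col_mx.
rewrite !dyE BE AE mulmxDl opprD !addrA; congr (col_mx (col_mx _ _) _).
by rewrite [X in X - _ = _]addrAC.
Qed.

Definition free_hom : kGhom free_mod N := KGHom free_hom_subproof.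
End Out.

Lemma free_homE (N : kGmod F gT) (f : kGhom free_mod N) :
  kGhom_mx f = free_hom_mx (usubmx (usubmx f)).
Proof.
rewrite /free_hom_mx.
pose u := usubmx f; pose d := dsubmx f.
have fE : kGhom_mx f = col_mx u d by rewrite vsubmxK.
have uE : u = col_mx (usubmx u) (dsubmx u) by rewrite vsubmxK.
have dE : d = col_mx (usubmx d) (dsubmx d) by rewrite vsubmxK.
have fx := kGhomE f x; have fy := kGhomE f y.
rewrite fE /= mul_block_col [RHS]mul_col_mx ychar_x scale0r !mul0mx add0r addr0 in fx.
rewrite fE /= mul_block_col [RHS]mul_col_mx ychar_y scale1r in fy.
rewrite mul0mx add0r free_block_y !mul1mx in fy.
have [fxu fxd] := eq_col_mx fx; have [fyu fyd] := eq_col_mx fy.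
have xE (w : 'M[F]_(m + m, rdegree N)) : free_block x *m w = w *m N x ->
    dsubmx w = usubmx w *m N x - usubmx w.
  rewrite -[w in X in X -> _]vsubmxK free_block_x mul_block_col mul_col_mx.
  rewrite !mul1mx mul0mx add0r.
  by case/eq_col_mx=> <- _; rewrite addrC addKr.
have dyE : usubmx d = usubmx u *m N y - usubmx u.
  by rewrite mul_usub_mx -fyu; apply/matrixP=> i j; rewrite !mxE addrC addKr.
by rewrite [LHS]fE -/u {1}uE {1}dE (xE _ fxu) (xE _ fxd) dyE.
Qed.

(** Any linear section, here the one over a subgroup in chi, lifts the images of
    the generators. *)
Lemma lifting_free (chi : {set {group gT}}) : chi != set0 -> lifting chi free_mod.
Proof.
case/set0Pn=> H Hchi X N p /(_ H Hchi)[w _ wp] f.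
exists (free_hom (usubmx (usubmx f) *m w)).
rewrite [RHS]free_homE /= /free_hom_mx.
have e (B : 'M_(m, _)) g : (B *m X g - B) *m p = (B *m p) *m N g - B *m p.
  by rewrite mulmxBl -!mulmxA kGhomE.
have wpE : usubmx (usubmx f) *m w *m p = usubmx (usubmx f) by rewrite -mulmxA wp mulmx1.
by rewrite !mul_col_mx !e wpE.
Qed.

Section In.
Variables (M : kGmod F gT) (D : 'M[F]_(rdegree M, m)).
Let Dy := M y *m D - D.

(** Free modules are coinduced: an arbitrary linear map D to k^m extends uniquely
    to a map to the free module of rank m with component D on e (y - 1) (x - 1).
    Equivariance makes (x - 1) D, (y - 1) D and (x - 1) (y - 1) D the components on
    e (y - 1), e (x - 1) and e; they are consistent because x - 1 and y - 1 have
    square zero in characteristic 2. *)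
Definition free_cohom_mx : 'M_(rdegree M, m + m + (m + m)) :=
  row_mx (row_mx (M x *m Dy - Dy) Dy) (row_mx (M x *m D - D) D).

Lemma free_cohom_subproof : (free_cohom_mx : 'M_(_, rdegree free_mod))
  \in repr_hom [set: gT] M free_mod.
Proof.
have rowE (B : 'M[F]_(rdegree M, m)) :
    row_mx (M x *m B - B) B *m free_block x = M x *m row_mx (M x *m B - B) B.
  rewrite free_block_x mul_row_block mul_mx_row !mulmx1 mulmx0 addr0 subrK.
  by rewrite mulmxBr sqr_repr mx_subrC2.
have DyE : M y *m Dy = Dy by rewrite /Dy mulmxBr sqr_repr mx_subrC2.
have dyE (B : 'M[F]_(rdegree M, m)) :
    M y *m (M x *m B - B) = M x *m (M y *m B) - M y *m B.
  by rewrite mulmxBr !repr_mulmxM klein_comm.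
have DyD : M y *m D = Dy + D by rewrite subrK.
rewrite /free_cohom_mx; move: (Dy) DyE DyD => B BE DE.
apply: kGhom_gen; rewrite /= mul_row_block [LHS]mul_mx_row.
  by rewrite ychar_x scale0r !mulmx0 addr0 add0r !rowE.
rewrite ychar_y scale1r free_block_y !mulmx1 mulmx0 addr0 !mul_mx_row add_row_mx.
rewrite !dyE BE DE mulmxDr opprD !addrA; congr (row_mx _ (row_mx _ _)).
by rewrite [X in X - _ = _]addrAC.
Qed.

Definition free_cohom : kGhom M free_mod := KGHom free_cohom_subproof.
End In.

Lemma free_cohom_hom (M N : kGmod F gT) (D : 'M_(rdegree M, m)) (A : 'M_(m, rdegree N)) :
  free_cohom D *m free_hom A =
    (M x *m (M y *m D - D) - (M y *m D - D)) *m A + (M y *m D - D) *m (A *m N x - A)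
    + ((M x *m D - D) *m (A *m N y - A) +
       D *m ((A *m N y - A) *m N x - (A *m N y - A))).
Proof. by rewrite [LHS]mul_row_col !mul_row_col. Qed.
End Free.

(** * Kronecker modules *)

Section Pencil.
Variable m : nat.

(** As polynomials in T, g - 1 multiplies the top by xchar g + ychar g T. *)
Definition pencil_mx (g : gT) : 'M[F]_(m, m.+1) :=
  xchar g *: skip_mx F ord_max + ychar g *: skip_mx F ord0.

Lemma pencil_mxM g h : pencil_mx (g * h)%g = pencil_mx g + pencil_mx h.
Proof. by rewrite /pencil_mx xcharM ycharM !scalerDl addrACA. Qed.

Definition pencil_mod : kGmod F gT := ext_mod pencil_mxM.

Lemma pencil_mx_x : pencil_mx x = skip_mx F ord_max.
Proof. by rewrite /pencil_mx xchar_x ychar_x scale1r scale0r addr0. Qed.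

Lemma pencil_mx_y : pencil_mx y = skip_mx F ord0.
Proof. by rewrite /pencil_mx xchar_y ychar_y scale1r scale0r add0r. Qed.

Lemma pencil_row n (u : 'M_(n, m)) (w : 'M_(n, m.+1)) g :
  (row_mx u w : 'M_(n, rdegree pencil_mod)) *m pencil_mod g =
  row_mx u (u *m pencil_mx g + w).
Proof. by rewrite /= mul_row_block !mulmx1 mulmx0 addr0. Qed.

Lemma pencil_col n (u : 'M_(m, n)) (w : 'M_(m.+1, n)) g :
  pencil_mod g *m (col_mx u w : 'M_(rdegree pencil_mod, n)) =
  col_mx (u + pencil_mx g *m w) w.
Proof. by rewrite /= mul_block_col !mul1mx mul0mx add0r. Qed.

Lemma socle_fix n (w : 'M_(n, m.+1)) g :
  (row_mx 0 w : 'M_(n, rdegree pencil_mod)) *m pencil_mod g = row_mx 0 w.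
Proof. by rewrite pencil_row mul0mx add0r. Qed.

Lemma socle_cofix g0 (w : 'cV_m.+1) : pencil_mx g0 *m w = 0 ->
  forall g, g \in <[g0]>%g ->
  pencil_mod g *m (col_mx 0 w : 'M_(rdegree pencil_mod, 1)) = col_mx 0 w.
Proof.
move=> w0; have [->|g0_neq1] := eqVneq g0 1%g.
  by move=> g; rewrite cycle1 inE => /eqP->; rewrite repr_mx1 mul1mx.
move=> g; rewrite klein_cycle // !inE => /orP[]/eqP->.
  by rewrite repr_mx1 mul1mx.
by rewrite pencil_col w0 addr0.
Qed.

End Pencil.

(** Let h11 and h22 be the maps induced by h on tops and socles. Commuting with
    x - 1 and y - 1 says that h22 extends h11 and that h22 (T u) = T h11 (u), so
    h11 multiplies by a fixed polynomial q; as T^(a-1) q has degree less than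
    b < a, q is zero. In matrix terms, the entries of h11 are constant along
    diagonals, and every diagonal leaves the matrix at a zero entry. *)
Lemma pencil_mod_hom0 a b (h : kGhom (pencil_mod a) (pencil_mod b))
    (f : kGhom (pencil_mod b) trivial_mod) :
  (0 < b < a)%N -> h *m f = 0.
Proof.
move=> /andP[b_gt0 ba].
pose h11 : 'M_(a, b) := ulsubmx h; pose h12 : 'M_(a, b.+1) := ursubmx h.
pose h21 : 'M_(a.+1, b) := dlsubmx h; pose h22 : 'M_(a.+1, b.+1) := drsubmx h.
have hE : kGhom_mx h = block_mx h11 h12 h21 h22 :=
  esym (submxK (kGhom_mx h : 'M_(a + a.+1, b + b.+1))).
have hom_g g : pencil_mx a g *m h21 = 0 /\
    pencil_mx a g *m h22 = h11 *m pencil_mx b g.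
  have := kGhomE h g; rewrite hE /= !mulmx_block.
  rewrite !mul1mx !mulmx1 !mul0mx !mulmx0 !addr0 !add0r.
  case/eq_block_mx=> e1 e2 _ _; split; first by apply: (addrI h11); rewrite e1 addr0.
  by apply: (addrI h12); rewrite e2 addrC.
pose f1 := usubmx f; pose f2 := dsubmx f.
have fE : kGhom_mx f = col_mx f1 f2 by rewrite vsubmxK.
have f2_0 : f2 = 0.
  have fg g : pencil_mx b g *m f2 = 0.
    have := kGhomE f g; rewrite fE /= mul_block_col mul1mx mulmx1.
    by case/eq_col_mx=> e _; apply: (addrI f1); rewrite e addr0.
  by apply: (skip_mx_inj b_gt0); rewrite -?pencil_mx_x -?pencil_mx_y fg.
have h21_0 : h21 = 0.
  apply: (skip_mx_inj (ltn_trans b_gt0 ba)).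
    by rewrite -pencil_mx_x; case: (hom_g x).
  by rewrite -pencil_mx_y; case: (hom_g y).
have [_ hx] := hom_g x; have [_ hy] := hom_g y.
rewrite !pencil_mx_x in hx; rewrite !pencil_mx_y in hy.
(* D extends the entries of h11 and h22 to all natural indices; a diagonal can
   then be followed without changing the type of its indices. *)
pose D i j : F := h22 (inord i) (inord j).
have DE (i : 'I_a) (j : 'I_b) : h11 i j = D i j.
  rewrite -(mul_skip_mx_lift ord_max) -hx skip_mxE.
  by congr (h22 _ _); apply: ord_inj; rewrite inordK ?lift_max // ltnS ltnW.
have DE1 (i : 'I_a) (j : 'I_b) : h11 i j = D i.+1 j.+1.
  rewrite -(mul_skip_mx_lift ord0) -hy skip_mxE.
  by congr (h22 _ _); apply: ord_inj; rewrite inordK ?lift0 ?ltnS.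
have Dtop i : (i < a)%N -> D i b = 0.
  move=> ia; rewrite -(mul_skip_mx0 ord_max h11 (Ordinal ia)) -hx skip_mxE.
  by congr (h22 _ _); apply: ord_inj; rewrite inordK ?lift_max // ltnS ltnW.
have Dbot i : (i < a)%N -> D i.+1 0%N = 0.
  move=> ia; rewrite -(mul_skip_mx0 ord0 h11 (Ordinal ia)) -hy skip_mxE.
  by congr (h22 _ _); apply: ord_inj; rewrite inordK ?lift0 ?ltnS.
have Ddiag t i j : (i + t <= a)%N -> (j + t <= b)%N -> D i j = D (i + t)%N (j + t)%N.
  elim: t => [|t IH]; first by rewrite !addn0.
  rewrite !addnS => ia jb; rewrite IH 1?ltnW //.
  by rewrite -(DE (Ordinal ia) (Ordinal jb)) DE1.
have h11_0 : h11 = 0.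
  apply/matrixP=> i j; rewrite [RHS]mxE DE; have [ij|ji] := leqP i j.
    rewrite (Ddiag (b - j)%N) ?subnKC ?Dtop //; have := ltn_ord j; lia.
  have -> : D i j = D (i - j)%N 0%N.
    by rewrite (Ddiag j (i - j)%N) ?add0n ?subnK // ltnW.
  have ia := ltn_ord i; have -> : (i - j = (i - j).-1.+1)%N by lia.
  by rewrite Dbot //; lia.
rewrite hE fE mul_block_col h11_0 h21_0 f2_0 !mul0mx !mulmx0 !addr0.
exact: col_mx0.
Qed.

(** * The relative covers of the Kronecker modules *)

(** The generator of k[G/H] is fixed by H. *)
Lemma row_gen_coset (H : {group gT}) (H_index : #|[set: gT] : H|%g = 2%N) h :
  h \in H ->
  (row_mx 1%:M 0 : 'M[F]_(1, 1 + 1)) *m coset_mod F_char2 H_index h = row_mx 1%:M 0.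
Proof.
move=> hH; rewrite /= mul_row_block !mulmx1 mul1mx mul0mx !addr0.
by rewrite /coset_char hH raddf0.
Qed.

Section Resolution.
Variable m : nat.
Local Notation P := (pencil_mod m).
Local Notation k_x := (coset_mod F_char2 x_index).
Local Notation k_y := (coset_mod F_char2 y_index).
Local Notation k_xy := (coset_mod F_char2 xy_index).

Definition pencil_cover_mod : kGmod F gT :=
  dadd_grepr (free_mod m) (dadd_grepr k_x (dadd_grepr k_y k_xy)).

(** The fixed vectors of <[g]> in the socle modulo the image of g - 1 form a line,
    spanned by T^m for g = x and by 1 for g = y and g = x y, since g - 1
    multiplies by 1, T and 1 + T respectively. *)
Definition socle_hom_x : kGhom k_x P := coset_hom F_char2 x_index y_notin
  (fun h _ => socle_fix (delta_mx 0 ord_max) h).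
Definition socle_hom_y : kGhom k_y P := coset_hom F_char2 y_index x_notin_y
  (fun h _ => socle_fix (delta_mx 0 ord0) h).
Definition socle_hom_xy : kGhom k_xy P := coset_hom F_char2 xy_index x_notin_xy
  (fun h _ => socle_fix (delta_mx 0 ord0) h).

Definition pencil_cover : kGhom pencil_cover_mod P :=
  dadd_col (free_hom (row_mx 1%:M 0 : 'M_(m, rdegree P)))
    (dadd_col socle_hom_x (dadd_col socle_hom_y socle_hom_xy)).

Lemma pencil_cover_mod_lifting : lifting (order2_subgroups gT) pencil_cover_mod.
Proof.
have chi_x := cycle_order2 x_neq1; have chi_y := cycle_order2 y_neq1.
have chi_xy := cycle_order2 xy_neq1.
apply: lifting_dadd; first by apply: lifting_free; apply/set0Pn; exists <[x]>%G.
apply: lifting_dadd; first exact: (@lifting_coset_mod _ _ _ _ _ _ y_notin _ chi_x).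
apply: lifting_dadd; first exact: (@lifting_coset_mod _ _ _ _ _ _ x_notin_y _ chi_y).
exact: (@lifting_coset_mod _ _ _ _ _ _ x_notin_xy _ chi_xy).
Qed.

(** Over <[g]>, the generators of the free part lift a basis of the top, and v
    lifts a vector w that completes the image of g - 1 to a basis of the socle. *)
Lemma pencil_cover_splits_on g (w : 'rV_m.+1) (v : 'rV_(rdegree pencil_cover_mod)) :
  g != 1%g -> v *m pencil_cover_mod g = v -> v *m pencil_cover = row_mx 0 w ->
  (forall n (u : 'M_(m.+1, n)), pencil_mx m g *m u = 0 -> w *m u = 0 -> u = 0) ->
  splits_on <[g]>%G pencil_cover.
Proof.
move=> g1 v_fix vw kerg.
pose A : 'M[F]_(m, rdegree pencil_cover_mod) :=
  row_mx (row_mx (row_mx 1%:M 0 : 'M_(m, m + m)) (0 : 'M_(m, m + m))) 0.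
have AE : A *m pencil_cover = row_mx 1%:M 0.
  by rewrite /= !mul_row_col !mul0mx mul1mx !addr0.
apply: (splits_involution (klein_order g1) (A := A) v_fix); first by rewrite /= addn1.
rewrite AE vw pencil_row mul1mx addr0; apply: row_full_ker => u.
rewrite -[u](vsubmxK (u : 'M_(m + m.+1, _))) !mul_col_mx !mul_row_col.
rewrite !mul1mx !mul0mx add0r addr0.
move/eqP; rewrite !col_mx_eq0 => /and3P[/eqP-> /eqP]; rewrite add0r => gu /eqP wu.
by rewrite (kerg _ _ gu wu) col_mx0.
Qed.

Lemma pencil_cover_split : chi_split (order2_subgroups gT) pencil_cover.
Proof.
pose e : 'M[F]_(1, 1 + 1) := row_mx 1%:M 0.
move=> H /klein_order2_subgroups[] ->.
- pose v : 'rV_(rdegree pencil_cover_mod) :=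
    row_mx (0 : 'M_(1, m + m + (m + m))) (row_mx e (0 : 'M_(1, 1 + 1 + (1 + 1)))).
  apply: (@pencil_cover_splits_on _ (delta_mx 0 ord_max) v) => //.
  + do 3?[apply: dadd_row_fix]; try exact: mul0mx; exact: row_gen_coset (cycle_id _).
  + by rewrite /v /= !mul_row_col !mul0mx mul1mx !addr0 add0r.
  move=> n u; rewrite pencil_mx_x; exact: skip_mx_row_inj.
- pose v : 'rV_(rdegree pencil_cover_mod) :=
    row_mx (0 : 'M_(1, m + m + (m + m)))
      (row_mx (0 : 'M_(1, 1 + 1)) (row_mx e (0 : 'M_(1, 1 + 1)))).
  apply: (@pencil_cover_splits_on _ (delta_mx 0 ord0) v); first exact: y_neq1.
  + do 3?[apply: dadd_row_fix]; try exact: mul0mx; exact: row_gen_coset (cycle_id _).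
  + by rewrite /v /= !mul_row_col !mul0mx mul1mx !addr0 !add0r.
  move=> n u; rewrite pencil_mx_y; exact: skip_mx_row_inj.
pose v : 'rV_(rdegree pencil_cover_mod) :=
  row_mx (0 : 'M_(1, m + m + (m + m)))
    (row_mx (0 : 'M_(1, 1 + 1)) (row_mx (0 : 'M_(1, 1 + 1)) e)).
apply: (@pencil_cover_splits_on _ (delta_mx 0 ord0) v); first exact: xy_neq1.
+ do 3?[apply: dadd_row_fix]; try exact: mul0mx; exact: row_gen_coset (cycle_id _).
+ by rewrite /v /= !mul_row_col !mul0mx mul1mx !addr0 !add0r.
move=> n u; rewrite pencil_mxM pencil_mx_x pencil_mx_y; exact: skip_mx_add_inj.
Qed.
End Resolution.

(** * The kernels of the covers *)

Section Syzygy.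
Variable m : nat.
Local Notation P := (pencil_mod m.+2).

Lemma pencil_col_sub g n (w : 'M_(m.+3, n)) :
  P g *m (col_mx 0 w : 'M_(rdegree P, n)) - col_mx 0 w = col_mx (pencil_mx m.+2 g *m w) 0.
Proof. by rewrite pencil_col add0r opp_col_mx add_col_mx subr0 subrr. Qed.

Lemma skip_delta0 n (p : 'I_n.+1) : skip_mx F p *m delta_mx p (0 : 'I_1) = 0.
Proof.
by apply/matrixP=> i j; rewrite skip_mxE !mxE eq_sym (negPf (neq_lift _ _)).
Qed.

Lemma skip_const n (p : 'I_n.+1) : skip_mx F p *m const_mx 1 = const_mx 1 :> 'cV_n.
Proof. by apply/matrixP=> i j; rewrite skip_mxE !mxE. Qed.

(** In characteristic 2 the quotient of q by T (T + 1) has coefficient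
    q_(k+2) + q_(k+3) + ... in degree k. Its last coefficient, for k = m, is left
    out: it is the leading coefficient of q, the value of q at oo. *)
Definition suffix_mx : 'M[F]_(m.+3, m) := \matrix_(i, j) (j.+2 <= i)%N%:R.

Lemma socle_cofix_x h : h \in <[x]>%g ->
  P h *m (col_mx 0 (delta_mx ord_max 0) : 'cV_(rdegree P)) = col_mx 0 (delta_mx ord_max 0).
Proof. by apply: socle_cofix; rewrite pencil_mx_x skip_delta0. Qed.

Lemma socle_cofix_y h : h \in <[y]>%g ->
  P h *m (col_mx 0 (delta_mx ord0 0) : 'cV_(rdegree P)) = col_mx 0 (delta_mx ord0 0).
Proof. by apply: socle_cofix; rewrite pencil_mx_y skip_delta0. Qed.

Lemma socle_cofix_xy h : h \in <[x * y]>%g ->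
  P h *m (col_mx 0 (const_mx 1) : 'cV_(rdegree P)) = col_mx 0 (const_mx 1).
Proof.
apply: socle_cofix; rewrite pencil_mxM pencil_mx_x pencil_mx_y mulmxDl !skip_const.
exact: mx_addrr2.
Qed.

(** The four components come from linear forms on the socle, the polynomials q of
    degree at most m + 2: the quotient by T (T + 1), and the values at the points
    oo (the leading coefficient), 0 and 1. The value at a point is invariant
    under the subgroup generated by g if the factor of g - 1 vanishes there: T at
    0 for y, 1 + T at 1 for x y, and 1, as a form of degree 1, at oo for x. *)
Definition syzygy_incl : kGhom P (pencil_cover_mod m) :=
  dadd_row (free_cohom (col_mx 0 suffix_mx : 'M_(rdegree P, m)))
    (dadd_row (coset_cohom F_char2 x_index y_notin socle_cofix_x)
      (dadd_row (coset_cohom F_char2 y_index x_notin_y socle_cofix_y)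
        (coset_cohom F_char2 xy_index x_notin_xy socle_cofix_xy))).

(** Multiplication by 1 and by T on a row of coefficients, with the index that
    falls outside the range made explicit. *)
Lemma mul_skip_mx_ends (b : nat -> F) n (B : 'M_(n, m)) i k :
  (forall j : 'I_m, B i j = b j) ->
  (B *m skip_mx F ord_max) i k = (if (k < m)%N then b k else 0) /\
  (B *m skip_mx F ord0) i k = (if k == 0 :> nat then 0 else b k.-1).
Proof.
move=> Bb; split.
  have [j ->|->] := unliftP ord_max k; last by rewrite mul_skip_mx0 /= ltnn.
  by rewrite mul_skip_mx_lift lift_max ltn_ord Bb.
have [j ->|->] := unliftP ord0 k; last by rewrite mul_skip_mx0.
by rewrite mul_skip_mx_lift lift0 Bb.
Qed.

(** For r of degree at most m + 1, let c and b be the quotients of r and T r by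
    T (T + 1), without their top coefficients. Then b + T c + r_(m+1) T^m + r(0)
    + r(1) = 0, which is the composite P_(m+2) -> Q -> P_m on the top. In terms of
    suffix sums every intermediate coefficient occurs twice, and the terms left
    over at both ends cancel against the values of r. *)
Lemma syzygy_identity :
  skip_mx F ord0 *m suffix_mx *m skip_mx F ord_max
  + skip_mx F ord_max *m suffix_mx *m skip_mx F ord0
  + skip_mx F ord0 *m delta_mx ord_max (0 : 'I_1) *m delta_mx (0 : 'I_1) ord_max
  + skip_mx F ord_max *m delta_mx ord0 (0 : 'I_1) *m delta_mx (0 : 'I_1) ord0
  + const_mx 1 *m delta_mx (0 : 'I_1) ord0 = 0 :> 'M_(m.+2, m.+1).
Proof.
apply/matrixP=> i k; rewrite [RHS]mxE.
have rk1 (u : 'cV[F]_m.+2) (q : 'I_m.+1) :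
    (u *m delta_mx (0 : 'I_1) q) i k = u i 0 * (k == q)%:R.
  by rewrite mxE big_ord1 !mxE eqxx.
have D1 (j : 'I_m) : (skip_mx F ord0 *m suffix_mx) i j = (j.+1 <= i)%N%:R.
  by rewrite skip_mxE mxE lift0.
have D2 (j : 'I_m) : (skip_mx F ord_max *m suffix_mx) i j = (j.+2 <= i)%N%:R.
  by rewrite skip_mxE mxE lift_max.
have [E1 _] := @mul_skip_mx_ends (fun j => (j.+1 <= i)%N%:R) _ _ i k D1.
have [_ E2] := @mul_skip_mx_ends (fun j => (j.+2 <= i)%N%:R) _ _ i k D2.
have addE (A B : 'M[F]_(m.+2, m.+1)) : (A + B) i k = A i k + B i k by rewrite mxE.
rewrite !addE E1 E2 !rk1 !skip_mxE !mxE !eqxx !andbT mul1r.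
rewrite -!val_eqE /= {2}/bump (leqNgt m.+2) ltn_ord add0n.
have ifE (c b : bool) : (if c then b%:R else 0) = (c && b)%:R :> F by case: c.
have ifEN (c b : bool) : (if c then 0 else b%:R) = (~~ c && b)%:R :> F by case: c.
(* All terms are images of natural numbers: what remains is that a sum of truth
   values is even. *)
rewrite ifE ifEN -!natrM -!natrD; apply/eqP; rewrite -(dvdn_pcharf F_char2) dvdn2.
have := ltn_ord i; have := ltn_ord k; rewrite /bump; lia.
Qed.

Lemma syzygy_incl_cover : syzygy_incl *m pencil_cover m = 0.
Proof.
have colrow n (a : 'M[F]_(m.+2, n)) (w : 'M_(n, m.+1)) :
    (col_mx a 0 : 'M_(rdegree P, n)) *m (row_mx 0 w : 'M_(n, rdegree (pencil_mod m)))
    = block_mx 0 (a *m w) 0 0.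
  by rewrite mul_col_mx mul_mx_row !mulmx0 mul0mx /block_mx row_mx0.
have row_sub n (w : 'M[F]_(n, m.+1)) g :
    (row_mx 0 w : 'M_(n, rdegree (pencil_mod m))) *m pencil_mod m g - row_mx 0 w = 0.
  by rewrite socle_fix subrr.
have gen_sub g : (row_mx 1%:M 0 : 'M_(m, rdegree (pencil_mod m))) *m pencil_mod m g
    - row_mx 1%:M 0 = row_mx 0 (pencil_mx m g).
  by rewrite pencil_row mul1mx addr0 opp_row_mx add_row_mx subrr subr0.
have col_sub0 n (a : 'M[F]_(m.+2, n)) g :
    P g *m (col_mx a 0 : 'M_(rdegree P, n)) - col_mx a 0 = 0.
  by rewrite pencil_col mulmx0 addr0 subrr.
rewrite !dadd_row_col free_cohom_hom !coset_cohom_hom.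
rewrite !pencil_col_sub !gen_sub !col_sub0 !row_sub !mul0mx !mulmx0 !addr0 !add0r.
rewrite !colrow !add_block_mx !addr0 !pencil_mx_x !pencil_mx_y.
by rewrite skip_const !addrA syzygy_identity block_mx0.
Qed.

(** The interpolation data determine a polynomial: all suffix sums s k of its
    coefficients vanish. Those with k > 1 are the coefficients of the quotient,
    s 0 is the value at 1, and s 1 is s 0 minus the value at 0. *)
Lemma suffix_ker n (q : 'M[F]_(n, m.+3)) :
  q *m suffix_mx = 0 -> q *m delta_mx ord_max (0 : 'I_1) = 0 ->
  q *m delta_mx ord0 (0 : 'I_1) = 0 -> q *m (const_mx 1 : 'cV_m.+3) = 0 -> q = 0.
Proof.
move=> q_suf q_max q_0 q_sum; apply/matrixP=> i j; rewrite [RHS]mxE.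
pose s k := \sum_(l < m.+3 | (k <= l)%N) q i l.
have sS (k : 'I_m.+3) : s k = q i k + s k.+1.
  rewrite /s (bigD1 k) //=; congr (_ + _); apply: eq_bigl => l.
  by rewrite ltn_neqAle andbC eq_sym.
have q_col (k : 'I_m.+3) : q *m delta_mx k (0 : 'I_1) = 0 -> q i k = 0.
  by rewrite -colE => /matrixP/(_ i 0); rewrite !mxE.
have s_big k : (m.+2 < k)%N -> s k = 0.
  by move=> mk; rewrite /s big1 // => l kl; have := ltn_ord l; lia.
have s0 : s 0%N = 0.
  move/matrixP: q_sum => /(_ i 0); rewrite !mxE => <-; rewrite /s.
  by apply: eq_bigr => l _; rewrite mxE mulr1.
have s_max : s m.+2 = 0 by rewrite (sS ord_max) q_col // s_big ?addr0.
have s1 : s 1%N = 0.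
  by rewrite -[RHS]s0 (sS ord0) q_col // add0r.
have s_mid k : (k < m)%N -> s k.+2 = 0.
  move=> km; move/matrixP: q_suf => /(_ i (Ordinal km)); rewrite !mxE => <-.
  rewrite /s big_mkcond; apply: eq_bigr => l _; rewrite mxE.
  by case: ifP => _; rewrite ?mulr1 ?mulr0.
have s_all k : s k = 0.
  case: k => [|[|k]] //; case: (ltngtP k m) => [/s_mid //|mk|-> //].
  by rewrite s_big // !ltnS.
by rewrite -[LHS]addr0 -(s_all j.+1) -sS s_all.
Qed.

(** A vector of the kernel has no component in the socle by interpolation. The
    same holds for its translate by x, whose socle component is the top component
    multiplied by 1. *)
Lemma syzygy_incl_free : row_free syzygy_incl.
Proof.
have soc0 n (u : 'M_(n, rdegree P)) : u *m syzygy_incl = 0 ->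
    rsubmx (u : 'M_(n, m.+2 + m.+3)) = 0.
  move=> u0; set q := rsubmx _.
  have uE b (d : 'M[F]_(m.+3, b)) : u *m (col_mx 0 d : 'M_(rdegree P, b)) = q *m d.
    by rewrite -[u](hsubmxK (u : 'M_(n, m.+2 + m.+3))) mul_row_col mulmx0 add0r.
  move/eqP: u0; rewrite mul_mx_row row_mx_eq0 => /andP[u_free].
  rewrite mul_mx_row row_mx_eq0 => /andP[u_x].
  rewrite mul_mx_row row_mx_eq0 => /andP[u_y u_xy].
  move: u_free; rewrite !mul_mx_row !row_mx_eq0 !uE => /andP[_ /andP[_ /eqP u_free]].
  move: u_x; rewrite mul_mx_row row_mx_eq0 uE => /andP[_ /eqP u_x].
  move: u_y; rewrite mul_mx_row row_mx_eq0 uE => /andP[_ /eqP u_y].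
  move: u_xy; rewrite mul_mx_row row_mx_eq0 uE => /andP[_ /eqP u_xy].
  exact: suffix_ker.
apply: row_free_ker => u u0.
pose l := lsubmx (u : 'M_(_, m.+2 + m.+3)).
have uE : u = row_mx l 0.
  by rewrite -[LHS](hsubmxK (u : 'M_(_, m.+2 + m.+3))) soc0.
have ux0 : u *m P x *m syzygy_incl = 0 by rewrite -mulmxA kGhomE mulmxA u0 mul0mx.
have := soc0 _ _ ux0; rewrite uE pencil_row addr0 row_mxKr pencil_mx_x => l0.
have -> : l = 0.
  by apply/matrixP=> i j; rewrite -(mul_skip_mx_lift ord_max) l0 !mxE.
exact: row_mx0.
Qed.

(** The inclusion of the image in the kernel is an equality by dimension:
    2m + 5 = (4m + 6) - (2m + 1). *)
Lemma syzygy_exact : (syzygy_incl :=: kermx (pencil_cover m))%MS.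
Proof.
have le : (syzygy_incl <= kermx (pencil_cover m))%MS.
  by apply/sub_kermxP; exact: syzygy_incl_cover.
have full : row_full (pencil_cover m).
  by have [s _ sE] := @pencil_cover_split m _ (cycle_order2 x_neq1); apply/row_fullP; exists s.
apply/eqmxP; rewrite -(mxrank_leqif_eq le) mxrank_ker (eqP full) (eqP syzygy_incl_free) /=.
by apply/eqP; lia.
Qed.
End Syzygy.

(** * Vanishing of cup products *)

(** P_0 is the trivial module, the start of the resolution. *)
Lemma pencil_mod0 g : pencil_mod 0 g = 1%:M :> 'M_(0 + 1).
Proof. by rewrite /= [pencil_mx 0 g]flatmx0 -scalar_mx_block. Qed.

Lemma trivial_pencil_subproof :
  (1%:M : 'M[F]_1) \in repr_hom [set: gT] trivial_mod (pencil_mod 0).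
Proof. by apply: kGhom_intro => g; rewrite pencil_mod0. Qed.

Lemma pencil_trivial_subproof :
  (1%:M : 'M[F]_1) \in repr_hom [set: gT] (pencil_mod 0) trivial_mod.
Proof. by apply: kGhom_intro => g; rewrite pencil_mod0. Qed.

Lemma klein_cup_eq0 (C : forall M : kGmod F gT, rel_cover (order2_subgroups gT) M)
    i j (a : rel_cohomology C i.+1 trivial_mod) (b : rel_cohomology C j.+1 trivial_mod) :
  cup a b = 0.
Proof.
apply: (@cup_eq0 _ _ _ C (fun n => pencil_mod n.*2) (fun n => pencil_cover_mod n.*2)
  (fun n => pencil_cover n.*2) (fun n => syzygy_incl n.*2) _ _ _ _
  (KGHom trivial_pencil_subproof) (KGHom pencil_trivial_subproof)).
- by move=> n; exact: pencil_cover_mod_lifting.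
- by move=> n; exact: pencil_cover_split.
- by move=> n; exact: syzygy_incl_free.
- by move=> n; exact: syzygy_exact.
- exact: mulmx1.
by move=> i' j' h f; apply: pencil_mod_hom0; lia.
Qed.
End KleinFour.

Theorem theorem2 (F : fieldType) (gT : finGroupType)
    (G_elementary : (2.-abelem [set: gT])%g) (G_order : #|gT| = 4%N)
    (F_char2 : 2%N \in [pchar F])
    (C : forall M : kGmod F gT, rel_cover (order2_subgroups gT) M)
    (i j : nat) (i_gt0 : (0 < i)%N) (j_gt0 : (0 < j)%N)
    (alpha1 : rel_cohomology C i trivial_mod)
    (alpha2 : rel_cohomology C j trivial_mod) :
  cup alpha1 alpha2 = 0.
Proof.
have [x _ x_neq1] : exists2 x, x \in [set: gT] & x != 1%g.
  by apply/trivgPn; rewrite trivg_card1 cardsT G_order.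
have [y _ y_notin] : exists2 y, y \in [set: gT] & y \notin <[x]>%g.
  apply/subsetPn; rewrite -indexg_eq1.
  by rewrite (klein_index G_elementary G_order x_neq1).
case: i i_gt0 alpha1 => // i _ alpha1; case: j j_gt0 alpha2 => // j _ alpha2.
exact: (klein_cup_eq0 F_char2 G_elementary G_order x_neq1 y_notin alpha1 alpha2).
Qed.
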